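(* Let $y\ge 0$. Under the standing assumptions on the random walk in time-inhomogeneous random environment given in the context, there exists a random variable $U(\xi,y)$ such that, for $P$-almost all $\xi$, $$\lim_{n\to\infty}U_n(\xi,y)=U(\xi,y):=-\mathbb{E}_\xi(S_{\tau_y}),$$ where $U_n(\xi,y)=\mathbb{E}_\xi(y+S_n;\tau_y>n)$.
   Context: Model: the environment $\xi=(\xi_n)_{n\ge1}$ is a stationary and ergodic sequence of random variables on a probability space $(\Omega_E,\mathscr{F}_E,P)$ with values in the space of probability laws on $\mathbb{R}$; each realization of $\xi_n$ corresponds to a law $\eta_n$ on $\mathbb{R}$. Given $\xi$, under the quenched probability $\mathbb{P}_\xi$ (expectation $\mathbb{E}_\xi$) the real random variables $X_1,X_2,\dots$ are independent and $X_n$ has law $\eta_n$; $S_0=0$ and $S_n=\sum_{k=1}^n X_k$. The annealed probability $\mathbb{P}$ (expectation $\mathbb{E}$) is given by $\int f\,d\mathbb{P}=\int\left(\int f(\xi,\omega)\,d\mathbb{P}_\xi(\omega)\right)dP$ for nonnegative measurable $f$. Standing assumptions: $\mathbb{E}_\xi(X_1)=0$ $P$-a.s.; $\mathbb{E}(|X_1|^{2+\epsilon})<\infty$ for some $\epsilon>0$; and $\mathbb{P}_\xi(X_1>0)>0$ $P$-a.s. Notation: $\mathbb{E}_\xi(Y;A):=\mathbb{E}_\xi(Y1_A)$. For $y\ge0$, $\tau_y:=\inf\{n>0:\ y+S_n\le 0\}$. *)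

(* Defs.v *)
From HB Require Import structures.
From mathcomp Require Import all_boot all_order all_algebra.
From mathcomp Require Import finmap.
From mathcomp Require Import all_classical all_reals all_analysis.

Set Implicit Arguments.
Unset Strict Implicit.
Unset Printing Implicit Defensive.
Import Order.TTheory GRing.Theory Num.Theory.
Import numFieldNormedType.Exports.
Local Open Scope classical_set_scope.
Local Open Scope ring_scope.

(* Sequences are 0-based: the entry of index n of an environment, and the
   increment X n, stand for what is written xi_{n+1} and X_{n+1} when indices
   start at 1.  The partial sums keep their usual index, S_n = X_1 + ... + X_n. *)

Section environment.
Context (R : realType).

(* probability laws on the line, with the sigma-algebra generated by the
   evaluations mu |-> mu A, A Borel *)
Definition law := pprobability (measurableTypeR R) R.

Definition cylinders : set (set (nat -> law)) :=
  \bigcup_n preimage_set_system setT (fun e : nat -> law => e n) measurable.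

(* sequences of laws, with the product sigma-algebra *)
Definition env := g_sigma_algebraType cylinders.

Definition shift (e : env) : env := fun n => e n.+1.

Context d (OE : measurableType d).
Implicit Types (P : probability OE R) (xi : nat -> {mfun OE >-> law}).

Definition env_of xi (w : OE) : env := fun n => xi n w.

Definition stationary P xi : Prop :=
  forall A : set env, measurable A ->
    P (env_of xi @^-1` (shift @^-1` A)) = P (env_of xi @^-1` A).

Definition ergodic P xi : Prop :=
  forall A : set env, measurable A -> shift @^-1` A = A ->
    P (env_of xi @^-1` A) = 0%E \/ P (env_of xi @^-1` A) = 1%E.

End environment.

Section walk.
Context (R : realType) d (Om : measurableType d).
Implicit Types (X : nat -> {mfun Om >-> measurableTypeR R}).
(* a measurable map into probability measures is a probability kernel *)
Implicit Types (Q : {mfun env R >-> pprobability Om R}).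

Definition mutually_independent (P : probability Om R) X : Prop :=
  forall (J : {fset nat}) (A : nat -> set (measurableTypeR R)),
    (forall n, measurable (A n)) ->
    P (\bigcap_(n in [set` J]) (X n @^-1` A n)) =
    (\prod_(n <- J) P (X n @^-1` A n))%E.

Definition quenched Q (e : env R) : probability Om R := Q e.

Definition quenched_model Q X : Prop :=
  forall e : env R,
    mutually_independent (quenched Q e) X /\
    (forall n (A : set (measurableTypeR R)), measurable A ->
      distribution (quenched Q e) (X n) A = (e n : probability _ R) A).

(* meant for nonnegative measurable f *)
Definition annealed_expectation d' (OE : measurableType d')
    (P : probability OE R) (xi : nat -> {mfun OE >-> law R}) Q
    (f : env R -> Om -> \bar R) : \bar R :=
  (\int[P]_w \int[quenched Q (env_of xi w)]_o f (env_of xi w) o)%E.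

Definition Sn X (n : nat) (o : Om) : R := \sum_(k < n) X k o.

(* tau_y, with None for the value +oo *)
Definition tau X (y : R) (o : Om) : option nat :=
  if pselect (exists n, (0 < n)%N && (y + Sn X n o <= 0)) is left h
  then Some (ex_minn h) else None.

Definition tau_gt X (y : R) (n : nat) : set Om :=
  [set o | if tau X y o is Some t then (n < t)%N else true].

(* S_{tau_y}; the value on {tau_y = +oo} is a dummy *)
Definition S_tau X (y : R) (o : Om) : R :=
  if tau X y o is Some t then Sn X t o else 0.

Definition Un Q X (n : nat) (e : env R) (y : R) : \bar R :=
  ('E_(quenched Q e)[fun o => ((y + Sn X n o) * \1_(tau_gt X y n) o)%R])%E.

End walk.

(* Main.v *)
Require Import Defs.
From HB Require Import structures.
From mathcomp Require Import all_boot all_order all_algebra.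
From mathcomp Require Import finmap.
From mathcomp Require Import all_classical all_reals all_analysis.
From mathcomp Require Import measurable_realfun ring lra zify.

Set Implicit Arguments.
Unset Strict Implicit.
Unset Printing Implicit Defensive.
Import Order.TTheory GRing.Theory Num.Theory.
Import numFieldNormedType.Exports.
Local Open Scope classical_set_scope.
Local Open Scope ring_scope.

(** A harmonic-function argument.  Kill the walk y + S_n when it leaves the
    positive half-line, and let u_n = U_n be the mean of the surviving walk and
    p_n = P_xi(tau_y > n).  Optional stopping gives
    u_n = E_xi(- S_tau; tau <= n) + y p_n, so it suffices that p_n -> 0 and that
    the nondecreasing sequence u_n is bounded.

    - p_n is small when u_n is: apply the martingale property to a convex
      potential that is quadratic up to level a and linear beyond; its drift is
      at least (v_k / 2a) (p_k - 2 u_k / a) with v_k = E_xi min(X_k^2, 1).  Summing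
      and choosing a = 4 (u_n + 1) / p_n yields
      p_n^2 (v_1 + ... + v_n) <= 32 (u_n + 1)^2.
    - u_n grows slowly when p_n is small: splitting the overshoot at level b,
      u_{k+1} + b p_{k+1} <= u_k + b p_k + b^-(1+eps) E_xi |X_k|^(2+eps) p_k.
    - By stationarity v_1 + ... + v_n >= c n with c > 0 random, which follows from
      the maximal ergodic inequality alone.  Hence p_n = O((u_n + 1) / sqrt n), and
      taking b = r^j with r < 2 < r^(1+eps) for 4^j <= k < 4^(j+1) one gets
      u_{4^(j+1)} + 1 <= (u_{4^j} + 1)(1 + c_j), where the sum of the c_j is almost
      surely finite because its random part has finite expectation. *)

(** * Real sequences and the potential *)

Section real_sequences.
Context {R : realType}.

(** A convex function: its slope jumps from 0 to 1 at the origin, grows linearly from 1 to 2 on ]0,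
    a] and stays 2 beyond. It vanishes on ]-oo, 0], so the cemetery contributes nothing, and its
    bound by [2 * z] ties its mean to u_n. *)
Definition potential (a z : R) : R :=
  if z <= 0 then 0 else if z <= a then z + z ^+ 2 / (2 * a) else 2 * z - a / 2.

(** On [0, +oo[ this is the right derivative of [potential a], a subgradient at 0. *)
Definition potential_slope (a z : R) : R := if z <= a then 1 + z / a else 2.

Lemma potential_ge0 (a z : R) : 0 < a -> 0 <= potential a z.
Proof.
move=> a0; rewrite /potential.
case: ifPn => // /negbTE; rewrite leNgt => /negbFE z0; case: ifPn => za.
  by rewrite addr_ge0 ?ltW// divr_gt0 ?exprn_gt0// mulr_gt0.
by move: za; rewrite -ltNge => za; lra.
Qed.

Lemma potential_le (a z : R) : 0 < a -> 0 <= z -> potential a z <= 2 * z.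
Proof.
move=> a0 z0; rewrite /potential.
case: ifPn => [_|_]; first lra.
case: ifPn => [za|_]; last lra.
suff : z ^+ 2 / (2 * a) <= z by lra.
rewrite ler_pdivrMr; last lra.
by rewrite expr2; nra.
Qed.

(** The potential normalized to a = 1; the general one is recovered by scaling. *)
Let phi (z : R) : R :=
  if z <= 0 then 0 else if z <= 1 then z + z ^+ 2 / 2 else 2 * z - 1 / 2.

Let potentialE (a z : R) : 0 < a -> potential a (a * z) = a * phi z.
Proof.
move=> a0; rewrite /potential /phi.
rewrite pmulr_rle0// -{2}(mulr1 a) ler_pM2l//.
case: ifPn => _; first by rewrite mulr0.
by case: ifPn => _; field; rewrite ?gt_eqF.
Qed.

(** For t >= 1/2 the term in [g] is nonpositive and convexity suffices. For t < 1/2 the gain over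
    the tangent line is s^2/2 as long as t + s stays in the quadratic zone. Above 1 the gain is at
    least 1/8; below 0 it is at least s^2/2 down to depth 2 and exceeds 2 further down, so one of
    the two bounds on [g] always applies. *)
Let phi_step (t s g : R) : 0 <= t -> 0 <= g -> g <= s ^+ 2 / 2 -> g <= 1 / 32 ->
  phi t + (if t <= 1 then 1 + t else 2) * s + g * (1 - 2 * t) <= phi (t + s).
Proof.
move=> t0 g0 gs g1; rewrite /phi.
have gt : g * (1 - 2 * t) <= g by nra.
have gt' : 1 / 2 <= t -> g * (1 - 2 * t) <= 0 by move=> ?; nra.
case: (leP t 0) => t0'.
  have t00 : t = 0 by lra.
  rewrite t00 add0r mulr0 subr0 mulr1 ler01 addr0 mul1r add0r.
  case: (leP s 0) => s0; first by case: (leP (-1) s) => s1; nra.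
  by case: (leP s 1) => s1; nra.
case: (leP t 1) => t1; case: (leP (t + s) 0) => z0.
- case: (leP (1 / 2) t) => t2; first by have := gt' t2; nra.
  by case: (leP (- 2) (t + s)) => z2; nra.
- case: (leP (t + s) 1) => z1.
    case: (leP (1 / 2) t) => t2; first by have := gt' t2; nra.
    by nra.
  case: (leP (1 / 2) t) => t2; first by have := gt' t2; nra.
  by nra.
- by have : g * (1 - 2 * t) <= 0 by [nra]; nra.
- have : g * (1 - 2 * t) <= 0 by nra.
  by case: (leP (t + s) 1) => z1; nra.
Qed.

(** This is [phi_step] multiplied by a, with t = w/a, s = x/a and g = min(x^2, 1)/(2 a^2).
    Truncating the square at 1, together with a >= 4, keeps g below 1/32 whatever the size of the
    step. *)
Lemma potential_step (a w x : R) : 4 <= a -> 0 <= w ->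
  potential a w + potential_slope a w * x
    + Num.min (x ^+ 2) 1 / (2 * a) * (1 - 2 * w / a) <= potential a (w + x).
Proof.
move=> a4 w0.
have a0 : 0 < a by lra.
have an0 : a != 0 by rewrite gt_eqF.
have [t wE] : exists t, w = a * t by exists (w / a); field.
have [s xE] : exists s, x = a * s by exists (x / a); field.
have t0 : 0 <= t by rewrite -(pmulr_rge0 _ a0) -wE.
set m := Num.min _ _.
have m0 : 0 <= m by rewrite le_min sqr_ge0 ler01.
have m1 : m <= 1 by rewrite ge_min lexx orbT.
have mx : m <= x ^+ 2 by rewrite ge_min lexx.
have a2 : 0 < 2 * a ^+ 2 by rewrite mulr_gt0 ?exprn_gt0.
have g0 : 0 <= m / (2 * a ^+ 2) by rewrite divr_ge0// ltW.
have gs : m / (2 * a ^+ 2) <= s ^+ 2 / 2.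
  rewrite ler_pdivrMr//.
  by rewrite (_ : s ^+ 2 / 2 * (2 * a ^+ 2) = x ^+ 2)// xE; field.
have g1 : m / (2 * a ^+ 2) <= 1 / 32 by rewrite ler_pdivrMr// expr2; nra.
have := phi_step t0 g0 gs g1.
rewrite -(ler_pM2l a0) -potentialE// [a * (t + s)]mulrDr -wE -xE; apply: le_trans.
rewrite [leRHS]mulrDr [a * (phi t + _)]mulrDr -potentialE// -wE /potential_slope.
rewrite (_ : w / a = t); last by rewrite wE; field.
rewrite (_ : (w <= a) = (t <= 1)); last by rewrite wE -{2}(mulr1 a) ler_pM2l.
rewrite le_eqVlt; apply/orP; left; apply/eqP.
by move: (potential a w) m {m0 m1 mx g0 gs g1} => b m; rewrite xE wE; field.
Qed.

Lemma discrete_gronwall (u c : nat -> R) (s : R) :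
  (forall j, 0 <= u j) -> (forall j, u j.+1 <= u j * (1 + c j)) ->
  (forall j, 0 <= c j) ->
  (forall J, \sum_(j < J) c j <= s) -> forall J, u J <= u 0%N * expR s.
Proof.
move=> u0 uS c0 cs J.
suff : u J <= u 0%N * expR (\sum_(j < J) c j).
  by move=> /le_trans; apply; rewrite ler_wpM2l// ler_expR.
elim: J => [|J IH]; first by rewrite big_ord0 expR0 mulr1.
rewrite (le_trans (uS J))// big_ord_recr/= expRD mulrA.
by rewrite ler_pM// ?addr_ge0// expR_ge1Dx.
Qed.

Lemma geometric_sum_le (q : R) (J : nat) : 0 <= q < 1 ->
  \sum_(j < J) q ^+ j <= (1 - q)^-1.
Proof.
move=> /andP[q0 q1].
rewrite -[leRHS]div1r ler_pdivlMr ?subr_gt0// mulrC -opprB mulNr -subrX1 opprB.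
by rewrite lerBlDr lerDl exprn_ge0.
Qed.

Lemma potential_decay (p u v : nat -> R) (n : nat) :
  (forall k, 0 <= p k) -> (forall k, p k.+1 <= p k) ->
  (forall k, 0 <= u k) -> (forall k, u k <= u k.+1) ->
  (forall k, 0 <= v k) ->
  (forall a, 4 <= a ->
    \sum_(k < n) v k / (2 * a) * (p k - 2 * u k / a) <= 2 * u n) ->
  p 0%N <= 1 ->
  p n ^+ 2 * \sum_(k < n) v k <= 32 * (u n + 1) ^+ 2.
Proof.
move=> p0 pS u0 uS v0 H p01.
have pm : {homo p : i j / (i <= j)%N >-> j <= i} by exact/nonincreasing_seqP.
have um : {homo u : i j / (i <= j)%N >-> i <= j} by exact/nondecreasing_seqP.
have := p0 n; rewrite le_eqVlt => /predU1P[<-|pn0].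
  by rewrite expr0n/= mul0r mulr_ge0// sqr_ge0.
have pn1 : p n <= 1 by rewrite (le_trans _ p01)// pm.
have un0 := u0 n.
(* With this level, 2 u_k / a <= p_n / 2 for every k <= n, so each bracket p_k - 2 u_k / a is at
   least p_n / 2. The added 1 and p_n <= 1 ensure a >= 4. *)
pose a := 4 * (u n + 1) / p n.
have a4 : 4 <= a by rewrite /a ler_pdivlMr//; nra.
have a0 : 0 < a by lra.
have : (\sum_(k < n) v k) / (2 * a) * (p n / 2) <= 2 * u n.
  apply: le_trans (H a a4); rewrite 2!mulr_suml; apply: ler_sum => k _.
  rewrite ler_wpM2l//; first by rewrite divr_ge0//; lra.
  have kn := ltnW (ltn_ord k).
  rewrite lerBrDr (_ : p n / 2 + _ = p n / 2 + 2 * u k / a)//.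
  rewrite (le_trans _ (pm _ _ kn))//.
  suff : 2 * u k / a <= p n / 2 by lra.
  rewrite ler_pdivrMr// /a (_ : p n / 2 * _ = 2 * (u n + 1)); last first.
    by field; rewrite gt_eqF.
  by have := um _ _ kn; lra.
set V := \sum_(k < n) v k.
rewrite (_ : V / (2 * a) * (p n / 2) = p n ^+ 2 * V / (16 * (u n + 1))); last first.
  by rewrite /a; field; rewrite gt_eqF ?gt_eqF//; lra.
rewrite ler_pdivrMr; last lra.
by rewrite expr2; move=> /le_trans; apply; rewrite expr2; nra.
Qed.

(** The level b is frozen on the block, so the inequalities telescope; each p_k is bounded by p_i
    and the final term b p_{i+n} is dropped. *)
Lemma block_recursion (p u m : nat -> R) (b be : R) (i n : nat) :
  0 <= b -> 0 < be -> (forall k, 0 <= p k) -> (forall k, p k.+1 <= p k) ->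
  (forall k, 0 <= m k) ->
  (forall k, u k.+1 + b * p k.+1 <= u k + b * p k + m k / be * p k) ->
  u (i + n)%N <= u i + p i * (b + (\sum_(i <= k < i + n) m k) / be).
Proof.
move=> b0 be0 p0 pS m0 H.
have pm : {homo p : i j / (i <= j)%N >-> j <= i} by exact/nonincreasing_seqP.
suff : u (i + n)%N + b * p (i + n)%N <=
       u i + p i * (b + (\sum_(i <= k < i + n) m k) / be).
  by apply: le_trans; rewrite lerDl mulr_ge0.
elim: n => [|n IH]; first by rewrite addn0 big_geq// mul0r addr0 mulrC.
rewrite addnS (le_trans (H _))// big_nat_recr ?leq_addr//=.
rewrite mulrDl !mulrDr !addrA lerD//; first by rewrite -addrA -mulrDr.
by rewrite mulrC ler_wpM2r ?pm ?leq_addr// divr_ge0// ltW.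
Qed.

Lemma bounded_of_recursion (p u v m : nat -> R) (c r be D : R) :
  (forall k, 0 <= p k) -> (forall k, p k.+1 <= p k) ->
  (forall k, 0 <= u k) -> (forall k, u k <= u k.+1) ->
  (forall k, 0 <= m k) -> 0 < c -> 0 < r < 2 -> 0 < be ->
  (forall k j, u k.+1 + r ^+ j * p k.+1 <=
               u k + r ^+ j * p k + m k / be ^+ j * p k) ->
  (forall n, p n ^+ 2 * \sum_(k < n) v k <= 32 * (u n + 1) ^+ 2) ->
  (forall n, c * n%:R <= \sum_(k < n) v k) ->
  (forall J, \sum_(j < J)
     (\sum_(4 ^ j <= k < 4 ^ j.+1) m k) / (2 * be) ^+ j <= D) ->
  exists M, (forall n, u n <= M) /\ p n @[n --> \oo] --> (0 : R).
Proof.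
move=> p0 pS u0 uS m0 c0 /andP[r0 r2] be0 Hs Hp Hv HD.
have um : {homo u : i j / (i <= j)%N >-> i <= j} by exact/nondecreasing_seqP.
have pc n : p n ^+ 2 * (c * n%:R) <= 32 * (u n + 1) ^+ 2.
  by apply: le_trans (Hp n); rewrite ler_wpM2l ?sqr_ge0.
pose s := Num.sqrt c; have s0 : 0 < s by rewrite sqrtr_gt0.
have ss : s ^+ 2 = c by rewrite sqr_sqrtr// ltW.
(* Any constant whose square is at least 32 would do in place of 6. At time 4^j the square root of
   the time is exactly 2^j. *)
pose K := 6 / s; have K0 : 0 < K by rewrite divr_gt0.
have p4 j : p (4 ^ j)%N <= K * (u (4 ^ j)%N + 1) / 2 ^+ j.
  have uj := u0 (4 ^ j)%N.
  have j0 : 0 < 2 ^+ j :> R by rewrite exprn_gt0.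
  rewrite /K -(@ler_pXn2r _ 2) ?nnegrE//; last first.
    by rewrite !mulr_ge0 ?invr_ge0// ltW//; lra.
  rewrite !exprMn !exprVn ss -exprM mulnC exprM -natrX -natrX.
  rewrite ler_pdivlMr ?ltr0n ?expn_gt0// mulrAC ler_pdivlMr//.
  rewrite mulrAC -mulrA.
  have := pc (4 ^ j)%N; rewrite natrX [c * _]mulrC => /le_trans; apply.
  by rewrite ler_wpM2r ?sqr_ge0// ler_nat.
(* The growth factor c_j of a block: the decay 2^-j of p turns the level r^j into a geometric term
   of ratio r/2 < 1, and the moment part into the sums controlled by D. *)
pose cc j : R := K * ((r / 2) ^+ j +
   (\sum_(4 ^ j <= k < 4 ^ j.+1) m k) / (2 * be) ^+ j).
have cc0 j : 0 <= cc j.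
  apply: mulr_ge0; first exact: ltW.
  apply: addr_ge0; first by rewrite exprn_ge0// divr_ge0// ltW.
  by rewrite divr_ge0 ?sumr_ge0// exprn_ge0// mulr_ge0// ltW.
have H4 j : u (4 ^ j.+1)%N + 1 <= (u (4 ^ j)%N + 1) * (1 + cc j).
  have -> : (4 ^ j.+1 = 4 ^ j + (4 ^ j * 3))%N by rewrite expnS; lia.
  have := @block_recursion p u m (r ^+ j) (be ^+ j) (4 ^ j) (4 ^ j * 3)
    (exprn_ge0 _ (ltW r0)) (exprn_gt0 _ be0) p0 pS m0 (Hs ^~ j).
  rewrite -(lerD2r 1) => /le_trans; apply.
  rewrite [leRHS]mulrDr mulr1 addrAC lerD2l.
  have -> : cc j = K / 2 ^+ j * (r ^+ j +
    (\sum_(4 ^ j <= k < 4 ^ j + 4 ^ j * 3) m k) / be ^+ j).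
    rewrite /cc; have -> : (4 ^ j.+1 = 4 ^ j + (4 ^ j * 3))%N by rewrite expnS; lia.
    by rewrite expr_div_n exprMn; field; rewrite !expf_neq0// gt_eqF.
  rewrite mulrA ler_wpM2r//; last by rewrite (le_trans (p4 j))// mulrA [K * _]mulrC.
  apply: addr_ge0; first by rewrite exprn_ge0// ltW.
  by rewrite divr_ge0 ?sumr_ge0// exprn_ge0// ltW.
have [M1 HM1] : exists M1, forall j, u (4 ^ j)%N + 1 <= M1.
  exists ((u (4 ^ 0)%N + 1) * expR (K * ((1 - r / 2)^-1 + D))).
  apply: (@discrete_gronwall (fun j => u (4 ^ j)%N + 1) cc) => //= [i|J].
    by have := u0 (4 ^ i)%N; lra.
  rewrite -mulr_sumr ler_pM2l// big_split/= lerD ?HD//.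
  by apply: geometric_sum_le; apply/andP; split; lra.
have HM n : u n + 1 <= M1.
  by rewrite (le_trans _ (HM1 n))// lerD2r um// ltnW// ltn_expl.
have M10 : 0 < M1 by have := u0 0%N; have := HM 0%N; lra.
exists M1; split; first by move=> n; have := HM n; lra.
(* Since p is nonincreasing, it is enough to make p small at one time 4^j, where p <= K M1 2^-j. *)
apply/cvgrPdist_lt => e e0.
have : (fun j => K * M1 * (1 / 2) ^+ j) @ \oo --> (K * M1 * 0 : R).
  apply: cvgMr; apply: cvg_expr; rewrite ger0_norm; lra.
rewrite mulr0 => /cvgrPdist_lt/(_ _ e0)[j _ Hj].
exists (4 ^ j)%N => //= n jn.
rewrite sub0r normrN ger0_norm//.
have := Hj j (leqnn j); rewrite /= sub0r normrN ger0_norm; last first.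
  by apply: mulr_ge0; [exact/ltW/mulr_gt0|apply: exprn_ge0; lra].
apply: le_lt_trans.
have pm : {homo p : i j / (i <= j)%N >-> j <= i} by exact/nonincreasing_seqP.
rewrite (le_trans (pm _ _ jn))// (le_trans (p4 j))// expr_div_n expr1n mul1r.
by rewrite ler_wpM2r ?invr_ge0 ?exprn_ge0// ler_wpM2l// ltW.
Qed.
End real_sequences.

(** * Integrals of nonnegative functions, one-step inequalities and centered laws *)

Section nonnegative_real_integrals.
Context {d} {T : measurableType d} {R : realType} (mu : {measure set T -> \bar R}).
Implicit Types f g : T -> R.
Local Open Scope ereal_scope.

Lemma ge0_integralD_EFin f g :
  measurable_fun setT f -> measurable_fun setT g ->
  (forall x, 0 <= f x)%R -> (forall x, 0 <= g x)%R ->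
  \int[mu]_x (f x + g x)%:E = \int[mu]_x (f x)%:E + \int[mu]_x (g x)%:E.
Proof.
move=> mf mg f0 g0; rewrite -ge0_integralD//=.
- by move=> x _; rewrite lee_fin.
- exact/measurable_EFinP.
- by move=> x _; rewrite lee_fin.
- exact/measurable_EFinP.
Qed.

Lemma ge0_integralZ_EFin f (k : R) :
  measurable_fun setT f -> (forall x, 0 <= f x)%R -> (0 <= k)%R ->
  \int[mu]_x (k * f x)%:E = k%:E * \int[mu]_x (f x)%:E.
Proof.
move=> mf f0 k0; rewrite -ge0_integralZl ?lee_fin//=.
- exact/measurable_EFinP.
- by move=> x _; rewrite lee_fin.
Qed.

Lemma ge0_le_integral_EFin f g :
  measurable_fun setT f -> measurable_fun setT g ->
  (forall x, 0 <= f x)%R -> (forall x, f x <= g x)%R ->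
  \int[mu]_x (f x)%:E <= \int[mu]_x (g x)%:E.
Proof.
move=> mf mg f0 fg; apply: ge0_le_integral => //=.
- by move=> x _; rewrite lee_fin.
- exact/measurable_EFinP.
- exact/measurable_EFinP.
- by move=> x _; rewrite lee_fin.
Qed.

Lemma measurable_fun_natb (f : T -> bool) :
  measurable_fun setT f -> measurable_fun setT (fun x => (f x)%:R : R).
Proof.
move=> mf; rewrite (_ : (fun _ => _) = fun x => if f x then 1%R else 0%R : R).
  by apply: measurable_fun_ifT.
by apply/funext => x; case: (f x).
Qed.

End nonnegative_real_integrals.

Lemma measurable_potential {R : realType} (a : R) :
  measurable_fun setT (potential a : measurableTypeR R -> measurableTypeR R).
Proof.
apply: measurable_fun_ifT => //; first exact: measurable_fun_ler.
apply: measurable_fun_ifT => //; first exact: measurable_fun_ler.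
  by apply: measurable_funD => //; apply: measurable_funM.
by apply: measurable_funB => //; exact: measurable_funM.
Qed.

Lemma measurable_normr_powR {R : realType} (p : R) :
  measurable_fun setT (fun x : measurableTypeR R => `|x| `^ p).
Proof. exact: (measurableT_comp (@measurable_powR R p)). Qed.

(** Only w + x <= 0 needs an argument: if |x| <= b, the level b absorbs the negative jump; if |x| >
    b, then |x| <= |x|^(2+eps) / b^(1+eps) does. The trailing [x] disappears once integrated against
    a centered law. *)
Lemma pos_part_step {R : realType} (w b eps x : R) :
  0 <= w -> 0 < b -> 0 < eps ->
  Num.max 0 (w + x) + b * (0 < w + x)%R%:R <=
  w + b + (b `^ (1 + eps))^-1 * `|x| `^ (2 + eps) + x.
Proof.
move=> w0 b0 e0.
have : 0 <= (b `^ (1 + eps))^-1 * `|x| `^ (2 + eps).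
  by rewrite mulr_ge0 ?invr_ge0 ?powR_ge0.
have [h|h] := ltP 0 (w + x); first by rewrite mulr1; lra.
rewrite mulr0 addr0 => kx.
have := ler_norm (- x); rewrite normrN => nx.
have [xb|xb] := leP `|x| b; first lra.
suff : `|x| <= (b `^ (1 + eps))^-1 * (`|x| `^ (2 + eps)) by lra.
rewrite mulrC ler_pdivlMr ?powR_gt0//.
rewrite (_ : 2 + eps = 1 + (1 + eps)); last by lra.
rewrite [leRHS]powRD; last by apply/implyP => /eqP; lra.
by rewrite powRr1// ler_wpM2l// ge0_ler_powR// ?nnegrE; lra.
Qed.

(** One step of optional stopping before integration: if the walk exits at z = w + x = y + S_tau,
    then y - z is -S_tau. For nonnegative w and y every term but [x] is nonnegative. *)
Lemma pos_part_stop {R : realType} (w y x : R) :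
  (w + x <= 0)%R%:R * (y - (w + x)) + w =
  Num.max 0 (w + x) + y * (w + x <= 0)%R%:R - x.
Proof.
by have [h|h] := leP (w + x) 0; rewrite ?mul1r ?mul0r ?mulr1 ?mulr0; lra.
Qed.

Lemma stop_ge0 {R : realType} (z y : R) :
  0 <= y -> 0 <= (z <= 0)%R%:R * (y - z).
Proof. by move=> y0; have [h|h] := leP z 0; rewrite ?mul0r ?mul1r//; lra. Qed.

Section centered_law.
Context {R : realType} (mu : probability (measurableTypeR R) R).
Local Open Scope ereal_scope.

Definition centered_law :=
  mu.-integrable setT (EFin \o idfun) /\ \int[mu]_x x%:E = 0.

Hypothesis mu0 : centered_law.

(** If the integral of g is infinite there is nothing to prove; otherwise g + c x is integrable and
    its linear part has integral 0. Working with nonnegative f and g avoids proving integrability at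
    each use. *)
Lemma centered_le_integral (f g : R -> R) (c : R) :
  measurable_fun setT f -> measurable_fun setT g ->
  (forall x, 0 <= f x)%R -> (forall x, 0 <= g x)%R ->
  (forall x, f x <= g x + c * x)%R ->
  \int[mu]_x (f x)%:E <= \int[mu]_x (g x)%:E.
Proof.
move=> mf mg f0 g0 fg; have [mu1 mu2] := mu0.
have [->|gfin] := eqVneq (\int[mu]_x (g x)%:E) +oo; first by rewrite leey.
have ig : mu.-integrable setT (EFin \o g).
  apply/integrableP; split; first exact/measurable_EFinP.
  under eq_integral do rewrite gee0_abs ?lee_fin ?g0//.
  by rewrite ltey.
have ic : mu.-integrable setT (fun x => c%:E * x%:E).
  exact: integrableZl mu1.
have -> : \int[mu]_x (g x)%:E = \int[mu]_x ((g x)%:E + c%:E * x%:E).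
  rewrite integralD//=.
  by rewrite integralZl//= mu2 mule0 adde0.
apply: ge0_le_integral => //=.
- by move=> x _; rewrite lee_fin.
- exact/measurable_EFinP.
- apply: emeasurable_funD; first exact/measurable_EFinP.
  by have /integrableP[] := ic.
- by move=> x _; rewrite -EFinM -EFinD lee_fin.
Qed.

End centered_law.

(** * The killed walk *)

(** Rectangles form a pi-system generating the product sigma-algebra, and the constant sequence
    [setT] is an exhaustion of finite measure. *)
Lemma eq_measure_rectangles d1 d2 (T1 : measurableType d1)
    (T2 : measurableType d2) (R : realType)
    (m1 m2 : {measure set (T1 * T2) -> \bar R}) :
  (m1 setT < +oo)%E ->
  (forall A B, measurable A -> measurable B -> m1 (A `*` B) = m2 (A `*` B)) ->
  forall D, measurable D -> m1 D = m2 D.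
Proof.
move=> fin m12 D mD.
pose C : set (set (T1 * T2)) :=
  [set E | exists A, measurable A /\ exists B, measurable B /\ E = A `*` B].
have CT : C setT.
  by exists setT; split => //; exists setT; split => //; rewrite setXTT.
apply: (measure_unique C (fun=> setT)) => //.
- rewrite measurable_prod_measurableType //; congr (<<s _ >>).
  rewrite predeqE; split => [[A mA [B mB <-]]|[A [mA [B [mB ->]]]]].
    by exists A; split => //; exists B.
  by exists A => //; exists B.
- move=> E F [A [mA [B [mB ->]]]] [A' [mA' [B' [mB' ->]]]].
  exists (A `&` A'); split; first exact: measurableI.
  exists (B `&` B'); split; first exact: measurableI.
  by rewrite setXI.
- by apply/seteqP; split => // x _; exists 0%N.
- by move=> E [A [mA [B [mB ->]]]]; exact: m12.
Qed.

Section killed_chain.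
Context {R : realType} {d} {Om : measurableType d} (P : probability Om R).
Variables (X : nat -> {mfun Om >-> measurableTypeR R}) (y : R).

(* -1 is the cemetery; the walk itself starts at y >= 0 and lives in [0, +oo[ *)
Definition killed_step (w x : R) : R :=
  if (0 <= w) && (0 < w + x) then w + x else -1.

Fixpoint killed (n : nat) (o : Om) : R :=
  if n is m.+1 then killed_step (killed m o) (X m o) else y.

Let mR : measurableType _ := measurableTypeR R.

Lemma measurable_killed_step :
  measurable_fun setT (fun z : mR * mR => killed_step z.1 z.2 : mR).
Proof.
have mD : measurable_fun setT (fun z : mR * mR => z.1 + z.2 : mR).
  exact: measurable_funD.
apply: measurable_fun_ifT => //.
by apply: measurable_and; [exact: measurable_fun_ler|exact: measurable_fun_ltr].
Qed.

Lemma measurable_killed n : measurable_fun setT (killed n : Om -> mR).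
Proof.
elim: n => [|n IH]; first exact: measurable_cst.
have mp : measurable_fun setT (fun o => (killed n o : mR, X n o : mR)).
  exact/measurable_fun_pair.
exact: (measurableT_comp measurable_killed_step mp).
Qed.

Definition killed_mfun n : {mfun Om >-> measurableTypeR R} :=
  HB.pack (killed n) (isMeasurableFun.Build _ _ _ (measurableTypeR R) (killed n)
    (measurable_killed n)).

Let pair n : Om -> mR * mR := fun o => (killed n o, X n o).

Let mpair n : measurable_fun setT (pair n).
Proof. by apply/measurable_fun_pair => //; exact: measurable_killed. Qed.

Hypothesis indep : mutually_independent P X.

(** The position at time n is independent of the increments from n on. The finite set J of future
    indices is kept general because the induction moves the index n from the future into the past:
    the position at n + 1 is a function of the position at n and of X_n. *)
Lemma killed_indep (n : nat) (J : {fset nat}) (B : set mR) (A : nat -> set mR) :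
  (forall k, k \in J -> (n <= k)%N) -> measurable B ->
  (forall k, measurable (A k)) ->
  P (killed n @^-1` B `&` \bigcap_(k in [set` J]) (X k @^-1` A k)) =
  (P (killed n @^-1` B) * \prod_(k <- J) P (X k @^-1` A k))%E.
Proof.
elim: n J B A => [|n IH] J B A nJ mB mA.
  rewrite (_ : killed 0 @^-1` B = if y \in B then setT else set0); last first.
    by rewrite (_ : killed 0 = cst y)// preimage_cst.
  case: ifPn => _; first by rewrite setTI probability_setT mul1e indep.
  by rewrite set0I measure0 mul0e.
set E := \bigcap_(k in _) _.
have mE : measurable E.
  apply: fin_bigcap_measurable; first exact: finite_fset.
  by move=> k _; rewrite -[X in measurable X]setTI; exact: measurable_funPT.
have nnJ : n \notin J by apply/negP => /nJ; rewrite ltnn.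
have PE : P E = (\prod_(k <- J) P (X k @^-1` A k))%E by exact: indep.
(* On rectangles, the induction hypothesis applies with n added to J and C prescribed for X_n, which
   is what [A'] encodes. *)
have rect (B' C : set mR) : measurable B' -> measurable C ->
    P (pair n @^-1` (B' `*` C) `&` E) = (P (pair n @^-1` (B' `*` C)) * P E)%E.
  move=> mB' mC.
  have pairE : pair n @^-1` (B' `*` C) = killed n @^-1` B' `&` X n @^-1` C by [].
  pose A' k := if k == n then C else A k.
  have mA' k : measurable (A' k) by rewrite /A'; case: ifP.
  have A'J k : k \in J -> A' k = A k.
    by move=> kJ; rewrite /A'; case: eqP => // kn; move: nnJ; rewrite -kn kJ.
  have h1 : P (pair n @^-1` (B' `*` C) `&` E) =
      (P (killed n @^-1` B') * \prod_(k <- (n |` J)%fset) P (X k @^-1` A' k))%E.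
    rewrite -IH//; last by move=> k; rewrite !inE => /predU1P[->//|/nJ/ltnW].
    rewrite pairE -setIA; congr (P (_ `&` _)).
    apply/seteqP; split => [z [Xn Ez] k /=|z h].
      by rewrite !inE => /predU1P[->|kJ];
        [rewrite /A' eqxx|rewrite A'J//; exact: Ez].
    split; first by have := h n; rewrite /A' eqxx; apply; rewrite /= !inE eqxx.
    by move=> k kJ; rewrite -A'J//; apply: h; rewrite /= !inE (_ : k \in J) ?orbT.
  have h2 : P (pair n @^-1` (B' `*` C)) =
      (P (killed n @^-1` B') * P (X n @^-1` C))%E.
    have := IH [fset n]%fset B' (fun=> C); rewrite big_seq_fset1 => <-//.
      rewrite pairE; congr (P (_ `&` _)).
      apply/seteqP; split => [z Xn k /=|z]; first by rewrite !inE => /eqP ->.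
      by apply; rewrite /= inE.
    by move=> k; rewrite !inE => /eqP ->.
  rewrite h1 h2 PE big_fsetU1//= -muleA; congr (_ * (_ * _))%E.
    by rewrite /A' eqxx.
  by apply: eq_big_seq => k kJ; rewrite A'J.
have PE0 : (0 <= fine (P E))%R by exact: fine_ge0.
have PEE : (fine (P E))%:E = P E by rewrite fineK// fin_num_measure.
pose D := (fun z : mR * mR => killed_step z.1 z.2 : mR) @^-1` B.
have mD : measurable D.
  by rewrite -[D]setTI; exact: measurable_killed_step.
transitivity (P (pair n @^-1` D `&` E)); first by [].
transitivity (P (pair n @^-1` D) * P E)%E; last by rewrite PE.
have mscE Z : mscale (NngNum PE0) (pushforward P (pair n)) Z =
    (P E * P (pair n @^-1` Z))%E by rewrite /mscale/= PEE.
(* Independence from E says that the law of the pair restricted to E is P(E) times its law; equality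
   on rectangles gives it on D, which need not be a rectangle. *)
have := @eq_measure_rectangles _ _ _ _ _ (pushforward (mrestr P mE) (pair n))
   (mscale (NngNum PE0) (pushforward P (pair n))) => H.
rewrite muleC -(mscE (mpair n)); apply: (H (mpair n) (mpair n)) => // [|A' C mA' mC].
  change (P (setT `&` E) < +oo)%E; rewrite setTI.
  by rewrite -ge0_fin_numE// fin_num_measure.
by apply: etrans (esym (mscE (mpair n) _)); rewrite muleC -rect.
Qed.

Lemma killed_pair_law n (D : set (mR * mR)) : measurable D ->
  P (pair n @^-1` D) =
  (distribution P (killed_mfun n) \x distribution P (X n))%E D.
Proof.
move=> mD; apply/esym.
apply: (@product_measure_unique _ _ _ _ _ (distribution P (killed_mfun n))
  (distribution P (X n)) (pushforward P (pair n))) => // A B mA mB.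
have := @killed_indep n [fset n]%fset A (fun=> B); rewrite big_seq_fset1 => <-//.
  rewrite /pushforward; congr (P (_ `&` _)).
  apply/seteqP; split => [z Xn k /=|z]; first by rewrite !inE => /eqP ->.
  by apply; rewrite /= inE.
by move=> k; rewrite !inE => /eqP ->.
Qed.

(** The Markov property in integral form: the joint law of the position and the next increment is a
    product, and Tonelli applies to it. *)
Lemma integral_killed_pair (n : nat) (f : mR * mR -> R) :
  measurable_fun setT f -> (forall z, 0 <= f z) ->
  (\int[P]_o (f (killed n o, X n o))%:E =
   \int[P]_o \int[distribution P (X n)]_x (f (killed n o, x))%:E)%E.
Proof.
move=> mf f0.
have mEf : measurable_fun setT (EFin \o f) by exact/measurable_EFinP.
have Ef0 z : (0 <= (EFin \o f) z)%E by rewrite lee_fin.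
transitivity (\int[pushforward P (pair n)]_z (EFin \o f) z)%E.
  by rewrite ge0_integral_pushforward.
rewrite (eq_measure_integral
  (distribution P (killed_mfun n) \x distribution P (X n))%E); last first.
  by move=> D mD _; exact: killed_pair_law.
rewrite fubini_tonelli1// /fubini_F ge0_integral_distribution//.
  exact: measurable_fun_fubini_tonelli_F.
by move=> w; exact: integral_ge0.
Qed.
End killed_chain.

(** A function that vanishes on ]-oo, 0] sees neither the cemetery nor the exit value, so killing
    can be replaced by the factor for being alive before the step. *)
Lemma killed_step_vanish {R : realType} (phi : R -> R) (w x : R) :
  (forall z, z <= 0 -> phi z = 0) ->
  phi (killed_step w x) = (0 <= w)%R%:R * phi (w + x).
Proof.
move=> phi0; have phiN1 : phi (-1) = 0 by rewrite phi0// lerN10.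
rewrite /killed_step; have [w0|w0] /= := leP 0 w; last by rewrite mul0r.
by rewrite mul1r; have [h|h] := ltP 0 (w + x); rewrite // phiN1 phi0.
Qed.

Lemma killed_step_alive {R : realType} (w x : R) :
  (0 <= killed_step w x)%R%:R = (0 <= w)%R%:R * (0 < w + x)%R%:R :> R.
Proof.
have N1 : (0 <= -1 :> R) = false by rewrite ler0N1.
rewrite /killed_step; have [w0|w0] /= := leP 0 w; last by rewrite mul0r N1.
rewrite mul1r; have [h|h] := ltP 0 (w + x); last by rewrite N1.
by rewrite ltW.
Qed.

Lemma pos_part_vanish {R : realType} (z : R) : z <= 0 -> Num.max 0 z = 0.
Proof. by move=> z0; apply/max_idPl. Qed.

Lemma potential_vanish {R : realType} (a z : R) : z <= 0 -> potential a z = 0.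
Proof. by move=> z0; rewrite /potential z0. Qed.

(** * One-step inequalities for means of the killed chain *)

Section killed_chain_integrals.
Context {R : realType} {d} {Om : measurableType d} (P : probability Om R).
Variables (X : nat -> {mfun Om >-> measurableTypeR R}) (y : R).
Hypothesis indep : mutually_independent P X.
Hypothesis X0 : forall n, centered_law (distribution P (X n)).
Hypothesis y0 : 0 <= y.
Local Open Scope ereal_scope.

Let mR : measurableType _ := measurableTypeR R.
Let W := killed X y.
Let mW n : measurable_fun setT (W n : Om -> mR).
Proof. exact: measurable_killed. Qed.

Let alive (w : R) : R := (0 <= w)%R%:R.

Let alive_ge0 w : (0 <= alive w)%R. Proof. by []. Qed.

Let malive : measurable_fun setT (alive : mR -> mR).
Proof. by apply: measurable_fun_natb; exact: measurable_fun_ler. Qed.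

Let malive_fst : measurable_fun setT (fun z : mR * mR => alive z.1 : mR).
Proof. exact: (measurableT_comp malive). Qed.

(** Given the position w, the increment is centered, so a term [c w * x] integrates to 0. The sub-
    and supermartingale estimates below are instances of this comparison. *)
Lemma integral_killed_centered_le n (f g : mR * mR -> R) (c : R -> R) :
  measurable_fun setT f -> measurable_fun setT g ->
  (forall z, 0 <= f z)%R -> (forall z, 0 <= g z)%R ->
  (forall w x : R, 0 <= w -> f (w, x) <= g (w, x) + c w * x)%R ->
  \int[P]_o ((0 <= W n o)%R%:R * f (W n o, X n o))%:E <=
  \int[P]_o ((0 <= W n o)%R%:R * g (W n o, X n o))%:E.
Proof.
move=> mf mg f0 g0 fg.
have maf : measurable_fun setT (fun z : mR * mR => alive z.1 * f z)%R.
  exact: measurable_funM.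
have mag : measurable_fun setT (fun z : mR * mR => alive z.1 * g z)%R.
  exact: measurable_funM.
have af0 z : (0 <= alive z.1 * f z)%R by exact: mulr_ge0.
have ag0 z : (0 <= alive z.1 * g z)%R by exact: mulr_ge0.
have := integral_killed_pair y indep n maf af0 => /= ->.
have := integral_killed_pair y indep n mag ag0 => /= ->.
have mF (h : mR * mR -> R) : measurable_fun setT h -> (forall z, 0 <= h z)%R ->
    measurable_fun setT (fun o => \int[distribution P (X n)]_x (h (W n o, x))%:E).
  move=> mh h0.
  have mEh : measurable_fun setT (EFin \o h) by exact/measurable_EFinP.
  have mH : measurable_fun setT (fubini_F (distribution P (X n)) (EFin \o h)).
    by apply: measurable_fun_fubini_tonelli_F => // z; rewrite lee_fin.
  exact: (measurableT_comp mH (mW n)).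
apply: ge0_le_integral => //.
- by move=> o _; apply: integral_ge0 => x _; rewrite lee_fin; exact: (af0 (W n o, x)).
- exact: (mF (fun z => alive z.1 * f z)%R).
- exact: (mF (fun z => alive z.1 * g z)%R).
move=> o _; apply: (@centered_le_integral _ _ (X0 n) _ _ (alive (W n o) * c (W n o))).
- exact: (measurableT_comp maf (pair1_measurable (W n o))).
- exact: (measurableT_comp mag (pair1_measurable (W n o))).
- by move=> x; exact: (af0 (W n o, x)).
- by move=> x; exact: (ag0 (W n o, x)).
move=> x /=; rewrite /alive; have [W0|_] := leP 0%R (W n o).
  by rewrite !mul1r fg.
by rewrite !mul0r addr0.
Qed.

Lemma integral_killed_prod n (h g : mR -> R) :
  measurable_fun setT h -> measurable_fun setT g ->
  (forall z, 0 <= h z)%R -> (forall z, 0 <= g z)%R ->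
  \int[P]_o (h (W n o) * g (X n o))%:E =
  \int[P]_o (h (W n o))%:E * \int[P]_o (g (X n o))%:E.
Proof.
move=> mh mg h0 g0.
have mEg : measurable_fun setT (EFin \o g) by exact/measurable_EFinP.
have mf : measurable_fun setT (fun z : mR * mR => h z.1 * g z.2)%R.
  by apply: measurable_funM; exact: measurableT_comp.
have := integral_killed_pair y indep n mf => /= ->; last by move=> z; exact: mulr_ge0.
have -> : \int[P]_o (g (X n o))%:E = \int[distribution P (X n)]_x (EFin \o g) x.
  by rewrite ge0_integral_distribution// => x; rewrite lee_fin.
rewrite muleC -ge0_integralZl//.
- apply: eq_integral => o _; rewrite ge0_integralZ_EFin// muleC//.
- exact/measurable_EFinP/(measurableT_comp mh).
- by move=> o _; rewrite lee_fin.
- by apply: integral_ge0 => x _; rewrite lee_fin.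
Qed.

Definition mean_pos n := \int[P]_o (Num.max 0 (W n o))%:E.

Definition survival n := \int[P]_o ((0 <= W n o)%R%:R)%:E.

Let mX n : measurable_fun setT (X n : Om -> mR).
Proof. exact: measurable_funPT. Qed.

Let mpos : measurable_fun setT (fun z : mR => Num.max 0 z : mR)%R.
Proof. exact: measurable_maxr. Qed.

Let pos_ge0 (z : R) : (0 <= Num.max 0 z)%R.
Proof. by rewrite le_max lexx. Qed.

Let mmin1 : measurable_fun setT (fun z : mR => Num.min (z ^+ 2) 1 : mR)%R.
Proof. by apply: measurable_minr => //; exact: measurable_funX. Qed.

Let min1_ge0 (z : R) : (0 <= Num.min (z ^+ 2) 1)%R.
Proof. by rewrite le_min sqr_ge0 ler01. Qed.

Let mWc n (h : mR -> mR) : measurable_fun setT h ->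
  measurable_fun setT (fun o => h (W n o)).
Proof. by move=> mh; exact: (measurableT_comp mh (mW n)). Qed.

Let mXc n (h : mR -> mR) : measurable_fun setT h ->
  measurable_fun setT (fun o => h (X n o)).
Proof. by move=> mh; exact: (measurableT_comp mh (mX n)). Qed.

Let msum : measurable_fun setT (fun z : mR * mR => z.1 + z.2 : mR)%R.
Proof. exact: measurable_funD. Qed.

Let maliveW n : measurable_fun setT (fun o => alive (W n o)).
Proof. exact: mWc. Qed.

Lemma mean_pos_ge0 n : 0 <= mean_pos n.
Proof. by apply: integral_ge0 => o _; rewrite lee_fin. Qed.

Lemma survival_ge0 n : 0 <= survival n.
Proof. by apply: integral_ge0 => o _; rewrite lee_fin. Qed.

Lemma mean_pos0 : mean_pos 0 = y%:E.
Proof.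
rewrite -[RHS]mule1 -(@probability_setT _ _ _ P) -integral_cst//.
by apply: eq_integral => o _; rewrite max_r.
Qed.

Lemma survival0 : survival 0 = 1.
Proof.
rewrite -[RHS](@probability_setT _ _ _ P) -[RHS]mul1e -integral_cst//.
by apply: eq_integral => o _; rewrite /= y0.
Qed.

Lemma survival_noninc n : survival n.+1 <= survival n.
Proof.
apply: ge0_le_integral_EFin => //; [exact: maliveW|exact: maliveW|].
by move=> o; rewrite killed_step_alive ler_piMr// lern1; case: (0 < _)%R.
Qed.

Lemma survival_fin_num n : survival n \is a fin_num.
Proof.
elim: n => [|n IH]; first by rewrite survival0.
rewrite ge0_fin_numE ?survival_ge0// (le_lt_trans (survival_noninc n))//.
by rewrite -ge0_fin_numE ?survival_ge0.
Qed.

Let mean_posE n :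
  mean_pos n = \int[P]_o ((0 <= W n o)%R%:R * Num.max 0 (W n o))%:E.
Proof.
apply: eq_integral => o _; have [h|h] := leP 0%R (W n o); first by rewrite mul1r.
by rewrite mul0r.
Qed.

Let mean_posSE n :
  mean_pos n.+1 = \int[P]_o ((0 <= W n o)%R%:R * Num.max 0 (W n o + X n o))%:E.
Proof.
apply: eq_integral => o _; congr EFin.
exact: (@killed_step_vanish _ (Num.max 0)%R _ _ (@pos_part_vanish R)).
Qed.

Let mfst_c (h : mR -> mR) : measurable_fun setT h ->
  measurable_fun setT (fun z : mR * mR => h z.1).
Proof. by move=> mh; exact: (measurableT_comp mh). Qed.

Let msnd_c (h : mR -> mR) : measurable_fun setT h ->
  measurable_fun setT (fun z : mR * mR => h z.2).
Proof. by move=> mh; exact: (measurableT_comp mh). Qed.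

Let msum_c (h : mR -> mR) : measurable_fun setT h ->
  measurable_fun setT (fun z : mR * mR => h (z.1 + z.2)%R).
Proof. by move=> mh; exact: (measurableT_comp mh). Qed.

Let mpair_c n (h : mR * mR -> mR) : measurable_fun setT h ->
  measurable_fun setT (fun o => h (W n o, X n o)).
Proof.
move=> mh; apply: (measurableT_comp mh); apply/measurable_fun_pair; [exact: mW|exact: mX].
Qed.

(** The positive part is convex, so it is a submartingale along the walk; the slope correction is
    -1. *)
Lemma mean_pos_nondec n : mean_pos n <= mean_pos n.+1.
Proof.
rewrite mean_posE mean_posSE.
apply: (@integral_killed_centered_le n (fun z => Num.max 0 z.1)%R
  (fun z => Num.max 0 (z.1 + z.2))%R (cst (- 1)%R)) => //.
- exact: mfst_c.
- exact: msum_c.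
move=> w x w0 /=; rewrite mulN1r lerBrDr max_r//.
by rewrite le_max lexx orbT.
Qed.

Let mlt0 : measurable_fun setT (fun z : mR => (0 < z)%R%:R : mR)%R.
Proof. by apply: measurable_fun_natb; exact: measurable_fun_ltr. Qed.

Let mle0 : measurable_fun setT (fun z : mR => (z <= 0)%R%:R : mR)%R.
Proof. by apply: measurable_fun_natb; exact: measurable_fun_ler. Qed.

Let max0_alive (w : R) : Num.max 0%R w = (alive w * Num.max 0 w)%R.
Proof. by rewrite /alive; have [h|h] := leP 0%R w; rewrite ?mul1r ?mul0r. Qed.

Let mDZ (f g : Om -> R) (k : R) : measurable_fun setT f -> measurable_fun setT g ->
  (forall o, 0 <= f o)%R -> (forall o, 0 <= g o)%R -> (0 <= k)%R ->
  \int[P]_o (f o + k * g o)%:E = \int[P]_o (f o)%:E + k%:E * \int[P]_o (g o)%:E.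
Proof.
move=> mf mg f0 g0 k0; rewrite ge0_integralD_EFin//; last 2 first.
- exact: measurable_funM.
- by move=> o; exact: mulr_ge0.
by rewrite ge0_integralZ_EFin.
Qed.

Let mposW n : measurable_fun setT (fun o => Num.max 0%R (W n o)).
Proof. exact: (mWc _ mpos). Qed.

(** Integrate [pos_part_step] at w = W_n over the living paths; independence of W_n and X_n splits
    the last term into survival times moment. *)
Lemma mean_pos_step n (b eps : R) : (0 < b)%R -> (0 < eps)%R ->
  mean_pos n.+1 + b%:E * survival n.+1 <=
  mean_pos n + b%:E * survival n +
  ((b `^ (1 + eps))^-1)%:E * (survival n * \int[P]_o (`|X n o| `^ (2 + eps))%:E).
Proof.
move=> b0 e0; have b0' := ltW b0.
have i0 : (0 <= (b `^ (1 + eps))^-1)%R by rewrite invr_ge0 powR_ge0.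
have mp := @measurable_normr_powR R (2 + eps).
rewrite -(mDZ (mposW n.+1) (maliveW n.+1))// -(mDZ (mposW n) (maliveW n))//.
have p0 (x : mR) : (0 <= `|x| `^ (2 + eps))%R by exact: powR_ge0.
rewrite -(integral_killed_prod n malive mp)//.
rewrite -mDZ//; last 4 first.
- by apply: measurable_funD => //; exact: measurable_funM.
- by apply: measurable_funM => //; exact: (mXc _ mp).
- by move=> o; rewrite addr_ge0// mulr_ge0.
- by move=> o; rewrite mulr_ge0.
have := @integral_killed_centered_le n
  (fun z => Num.max 0 (z.1 + z.2) + b * (0 < z.1 + z.2)%R%:R)%R
  (fun z => Num.max 0 z.1 + b + (b `^ (1 + eps))^-1 * `|z.2| `^ (2 + eps))%R
  (cst 1%R) => /=.
have -> : \int[P]_o ((0 <= W n o)%R%:R * (Num.max 0 (W n o + X n o) +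
    b * (0 < W n o + X n o)%R%:R))%:E =
  \int[P]_o (Num.max 0 (W n.+1 o) + b * (0 <= W n.+1 o)%R%:R)%:E.
  apply: eq_integral => o _; congr EFin; rewrite mulrDr mulrCA -killed_step_alive.
  by rewrite -(@killed_step_vanish _ (Num.max 0)%R _ _ (@pos_part_vanish R)).
have -> : \int[P]_o ((0 <= W n o)%R%:R * (Num.max 0 (W n o) + b +
    (b `^ (1 + eps))^-1 * `|X n o| `^ (2 + eps)))%:E =
  \int[P]_o (Num.max 0 (W n o) + b * alive (W n o) +
    (b `^ (1 + eps))^-1 * (alive (W n o) * `|X n o| `^ (2 + eps)))%:E.
  apply: eq_integral => o _; congr EFin; rewrite [in RHS]max0_alive.
  by rewrite !mulrDr [(_ * b)%R]mulrC [in LHS]mulrCA.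
apply.
- apply: measurable_funD; first exact: msum_c.
  by apply: measurable_funM => //; exact: (msum_c mlt0).
- apply: measurable_funD; first by apply: measurable_funD => //; exact: mfst_c.
  by apply: measurable_funM => //; exact: (msnd_c mp).
- by move=> z; rewrite addr_ge0// mulr_ge0.
- by move=> z; rewrite !addr_ge0// mulr_ge0.
move=> w x w0; rewrite mul1r (max_r w0).
exact: pos_part_step.
Qed.

(** The mean of [potential_step]. The drift v/(2a) (p_n - 2 u_n / a) is distributed over the two
    sides, so that only nonnegative quantities are integrated; the coefficient of u_n v becomes
    1/a^2. *)
Lemma mean_potential_step n (a : R) : (4 <= a)%R ->
  forall v, v = \int[P]_o (Num.min (X n o ^+ 2) 1)%:E ->
  \int[P]_o (potential a (W n o))%:E + ((2 * a)^-1)%:E * (survival n * v) <=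
  \int[P]_o (potential a (W n.+1 o))%:E + ((a ^+ 2)^-1)%:E * (mean_pos n * v).
Proof.
move=> a4 v ->; have a0 : (0 < a)%R by lra.
have i0 : (0 <= (2 * a)^-1)%R by rewrite invr_ge0; lra.
have i1 : (0 <= (a ^+ 2)^-1)%R by rewrite invr_ge0 sqr_ge0.
have mpot := @measurable_potential R a.
have pot0 (z : R) : (0 <= potential a z)%R by exact: potential_ge0.
rewrite -(integral_killed_prod n malive mmin1)// -(integral_killed_prod n mpos mmin1)//.
rewrite -mDZ//; last 3 first.
- exact: (mWc _ mpot).
- by apply: measurable_funM => //; exact: (mXc _ mmin1).
- by move=> o; rewrite mulr_ge0.
rewrite -mDZ//; last 3 first.
- exact: (mWc _ mpot).
- by apply: measurable_funM => //; exact: (mXc _ mmin1).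
- by move=> o; rewrite mulr_ge0.
have := @integral_killed_centered_le n
  (fun z => potential a z.1 + (2 * a)^-1 * Num.min (z.2 ^+ 2) 1)%R
  (fun z => potential a (z.1 + z.2) +
    (a ^+ 2)^-1 * (Num.max 0 z.1 * Num.min (z.2 ^+ 2) 1))%R
  (fun w => - potential_slope a w)%R => /=.
have -> : \int[P]_o ((0 <= W n o)%R%:R * (potential a (W n o) +
    (2 * a)^-1 * Num.min (X n o ^+ 2) 1))%:E =
  \int[P]_o (potential a (W n o) + (2 * a)^-1 *
    (alive (W n o) * Num.min (X n o ^+ 2) 1))%:E.
  apply: eq_integral => o _; congr EFin; rewrite mulrDr mulrCA; congr (_ + _)%R.
  have [h|h] := leP 0%R (W n o); first by rewrite mul1r.
  by rewrite mul0r potential_vanish// ltW.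
have -> : \int[P]_o ((0 <= W n o)%R%:R * (potential a (W n o + X n o) +
    (a ^+ 2)^-1 * (Num.max 0 (W n o) * Num.min (X n o ^+ 2) 1)))%:E =
  \int[P]_o (potential a (W n.+1 o) + (a ^+ 2)^-1 *
    (Num.max 0 (W n o) * Num.min (X n o ^+ 2) 1))%:E.
  apply: eq_integral => o _; congr EFin; rewrite mulrDr; congr (_ + _)%R.
    by rewrite -(@killed_step_vanish _ (potential a) _ _ (@potential_vanish R a)).
  by rewrite mulrCA; congr (_ * _)%R; rewrite mulrA [in RHS]max0_alive.
apply.
- apply: measurable_funD; first exact: (mfst_c mpot).
  by apply: measurable_funM => //; exact: (msnd_c mmin1).
- apply: measurable_funD; first exact: (msum_c mpot).
  apply: measurable_funM => //; apply: measurable_funM; first exact: (mfst_c mpos).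
  exact: (msnd_c mmin1).
- by move=> z; rewrite addr_ge0// mulr_ge0.
- by move=> z; rewrite addr_ge0// !mulr_ge0.
move=> w x w0; rewrite (max_r w0); have := potential_step x a4 w0.
have -> : (Num.min (x ^+ 2) 1 / (2 * a) * (1 - 2 * w / a) =
  (2 * a)^-1 * Num.min (x ^+ 2) 1 - (a ^+ 2)^-1 * (w * Num.min (x ^+ 2) 1))%R.
  by field; lra.
by lra.
Qed.

(** The first integral is the mean of -S_tau over the paths with tau = n + 1. The identity is stated
    without subtraction because its terms live in the extended reals. *)
Lemma mean_stopped_step n :
  \int[P]_o ((0 <= W n o)%R%:R *
      ((W n o + X n o <= 0)%R%:R * (y - (W n o + X n o))))%:E
    + mean_pos n + y%:E * survival n.+1 = mean_pos n.+1 + y%:E * survival n.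
Proof.
pose f (z : mR * mR) : R :=
  ((z.1 + z.2 <= 0)%R%:R * (y - (z.1 + z.2)) + Num.max 0 z.1)%R.
pose g (z : mR * mR) : R :=
  (Num.max 0 (z.1 + z.2) + y * (z.1 + z.2 <= 0)%R%:R)%R.
have mstop : measurable_fun setT (fun z : mR => (z <= 0)%R%:R * (y - z) : mR)%R.
  by apply: measurable_funM => //; exact: measurable_funB.
have mf : measurable_fun setT f.
  by apply: measurable_funD; [exact: (msum_c mstop)|exact: mfst_c].
have mg : measurable_fun setT g.
  apply: measurable_funD; first exact: msum_c.
  by apply: measurable_funM => //; exact: (msum_c mle0).
have f0 z : (0 <= f z)%R by rewrite addr_ge0// stop_ge0.
have g0 z : (0 <= g z)%R by rewrite addr_ge0// mulr_ge0.
have maf : measurable_fun setT (fun z : mR * mR =>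
    alive z.1 * ((z.1 + z.2 <= 0)%R%:R * (y - (z.1 + z.2))) : mR)%R.
  by apply: measurable_funM => //; exact: (msum_c mstop).
have mal : measurable_fun setT (fun z : mR * mR =>
    alive z.1 * (z.1 + z.2 <= 0)%R%:R : mR)%R.
  by apply: measurable_funM => //; exact: (msum_c mle0).
(* Being alive at time n splits into dying at the next step and surviving it. *)
have -> : survival n = \int[P]_o (alive (W n o) * (W n o + X n o <= 0)%R%:R)%:E +
    survival n.+1.
  rewrite -ge0_integralD_EFin//; last 3 first.
  - exact: (mpair_c n mal).
  - exact: maliveW.
  - by move=> o; exact: mulr_ge0.
  apply: eq_integral => o _; congr EFin; rewrite killed_step_alive -mulrDr.
  by have [h|h] := leP (W n o + X n o)%R 0%R; rewrite ?addr0 ?add0r mulr1.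
have le0 : 0 <= \int[P]_o (alive (W n o) * (W n o + X n o <= 0)%R%:R)%:E.
  by apply: integral_ge0 => o _; rewrite lee_fin; exact: mulr_ge0.
rewrite (ge0_muleDr _ le0 (survival_ge0 _)).
rewrite [in RHS]addeA; move: (y%:E * survival n.+1) => s; congr (_ + s).
rewrite /mean_pos -ge0_integralD_EFin//; last 2 first.
- exact: (mpair_c n maf).
- by move=> o; rewrite mulr_ge0// stop_ge0.
rewrite -mDZ//; last 2 first.
- exact: (mpair_c n mal).
- by move=> o; exact: mulr_ge0.
transitivity (\int[P]_o ((0 <= W n o)%R%:R * f (W n o, X n o))%:E).
  apply: eq_integral => o _; congr EFin; rewrite /f [in RHS]mulrDr.
  by rewrite [in LHS]max0_alive.
transitivity (\int[P]_o ((0 <= W n o)%R%:R * g (W n o, X n o))%:E); last first.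
  apply: eq_integral => o _; congr EFin; rewrite /g mulrDr mulrCA.
  by rewrite -(@killed_step_vanish _ (Num.max 0)%R _ _ (@pos_part_vanish R)).
(* The pointwise identity f = g - x is used as two inequalities, with slopes -1 and 1. *)
apply/eqP; rewrite eq_le; apply/andP; split.
  apply: (@integral_killed_centered_le n _ _ (cst (- 1)%R)) => // w x w0.
  by rewrite mulN1r /f /g/= (max_r w0) pos_part_stop.
apply: (@integral_killed_centered_le n _ _ (cst 1%R)) => // w x w0.
by rewrite mul1r /f /g/= (max_r w0) -lerBlDr pos_part_stop.
Qed.

End killed_chain_integrals.

(** * Boundedness of the killed mean *)

Lemma powR_exprn {R : realType} (r s : R) (k : nat) :
  0 <= r -> (r ^+ k) `^ s = (r `^ s) ^+ k.
Proof.
move=> r0; rewrite -(powR_mulrn k r0) -(powR_mulrn k (powR_ge0 r s)).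
by rewrite -!powRrM mulrC.
Qed.

Section killed_chain_bound.
Context {R : realType} {d} {Om : measurableType d} (P : probability Om R).
Variables (X : nat -> {mfun Om >-> measurableTypeR R}) (y : R).
Hypothesis indep : mutually_independent P X.
Hypothesis X0 : forall n, centered_law (distribution P (X n)).
Hypothesis y0 : 0 <= y.

Let W := killed X y.
Let u n := mean_pos P X y n.
Let p n := survival P X y n.
Let v n := (\int[P]_o (Num.min (X n o ^+ 2) 1)%:E)%E.
Let m (eps : R) n := (\int[P]_o (`|X n o| `^ (2 + eps))%:E)%E.

Let p_fin n : p n \is a fin_num.
Proof. exact: survival_fin_num. Qed.

Let v_ge0 n : (0 <= v n)%E.
Proof.
by apply: integral_ge0 => o _; rewrite lee_fin le_min sqr_ge0 ler01.
Qed.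

Let v_fin n : v n \is a fin_num.
Proof.
rewrite ge0_fin_numE// (@le_lt_trans _ _ 1%E) ?ltry//.
have <- : (\int[P]_o (cst 1%R o : R)%:E = 1)%E.
  by rewrite -[RHS](@probability_setT _ _ _ P) -[RHS]mul1e -integral_cst.
apply: (@ge0_le_integral_EFin _ _ _ P _ (cst 1)) => // [|o|o].
- have mX : measurable_fun setT (X n : Om -> measurableTypeR R).
    exact: measurable_funPT.
  by apply: measurable_minr => //; exact: measurable_funX.
- by rewrite le_min sqr_ge0 ler01.
- by rewrite ge_min lexx orbT.
Qed.

Section bound.
Variables (eps r c D : R).
Hypotheses (eps0 : 0 < eps) (r02 : 0 < r < 2) (c0 : 0 < c).
Hypothesis m_fin : forall n, (m eps n < +oo)%E.
Hypothesis v_lower : forall n, c * n%:R <= \sum_(k < n) fine (v k).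
Hypothesis m_blocks : forall J, \sum_(j < J)
  (\sum_(4 ^ j <= k < 4 ^ j.+1) fine (m eps k)) / (2 * r `^ (1 + eps)) ^+ j <= D.

Let m_ge0 n : (0 <= m eps n)%E.
Proof. by apply: integral_ge0 => o _; rewrite lee_fin powR_ge0. Qed.

Let mfin n : m eps n \is a fin_num.
Proof. by rewrite ge0_fin_numE. Qed.

Let u_fin n : u n \is a fin_num.
Proof.
elim: n => [|n IH]; first by rewrite /u mean_pos0.
rewrite ge0_fin_numE ?mean_pos_ge0//.
(* Level b = 1 is enough to propagate finiteness of the mean. *)
have := mean_pos_step y indep X0 n ltr01 eps0.
rewrite -/(u n.+1) -/(u n) -/(p n) -/(p n.+1) -/(m eps n) => h.
apply: (@le_lt_trans _ _ (u n.+1 + 1%:E * p n.+1)%E).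
  by rewrite leeDl// mule_ge0 ?lee_fin// survival_ge0.
apply: le_lt_trans h _.
by rewrite -(fineK IH) -(fineK (p_fin n)) -(fineK (mfin n)) -!EFinM -!EFinD ltry.
Qed.

(** The one-step drifts telescope to q_n - q_0, where q_k is the mean potential; then q_n <= 2 u_n
    and q_0 >= 0. *)
Let potential_sum n (a : R) : 4 <= a ->
  \sum_(k < n) fine (v k) / (2 * a) * (fine (p k) - 2 * fine (u k) / a) <=
  2 * fine (u n).
Proof.
move=> a4; have a0 : 0 < a by lra.
pose q n := (\int[P]_o (potential a (W n o))%:E)%E.
have mW k : measurable_fun setT (W k : Om -> measurableTypeR R).
  exact: measurable_killed.
have mpW k : measurable_fun setT (fun o => potential a (W k o)).
  exact: (measurableT_comp (measurable_potential a) (mW k)).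
have mposW k : measurable_fun setT (fun o => Num.max 0 (W k o)).
  by apply: measurable_maxr => //; exact: mW.
have q0 k : (0 <= q k)%E.
  by apply: integral_ge0 => o _; rewrite lee_fin potential_ge0.
have pos0 (z : R) : 0 <= Num.max 0 z by rewrite le_max lexx.
have qu k : (q k <= 2%:E * u k)%E.
  rewrite -ge0_integralZ_EFin//.
  apply: ge0_le_integral_EFin => // [|o|o].
  - exact: measurable_funM.
  - exact: potential_ge0.
  have [h|h] := leP 0 (W k o); first exact: potential_le.
  by rewrite potential_vanish ?mulr0// ltW.
have qfin k : q k \is a fin_num.
  rewrite ge0_fin_numE// (le_lt_trans (qu k))//.
  by rewrite -(fineK (u_fin k)) -EFinM ltry.
apply: (@le_trans _ _ (fine (q n) - fine (q 0%N))); last first.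
  have : fine (q n) <= 2 * fine (u n).
    by rewrite -lee_fin EFinM !fineK// qu.
  by have := fine_ge0 (q0 0%N); lra.
elim: n => [|n IH]; first by rewrite big_ord0 subrr.
rewrite big_ord_recr/= -lerBrDr (le_trans IH)//.
have := mean_potential_step y indep X0 a4 (erefl (v n)).
rewrite -/(u n) -/(p n) -/(v n) -/(q n) -/(q n.+1).
rewrite -(fineK (u_fin n)) -(fineK (p_fin n)) -(fineK (v_fin n)).
rewrite -(fineK (qfin n)) -(fineK (qfin n.+1)) -!EFinM -!EFinD lee_fin.
set un := fine (u n); set pn := fine (p n); set vn := fine (v n).
have -> : vn / (2 * a) * (pn - 2 * un / a) =
  (2 * a)^-1 * (pn * vn) - (a ^+ 2)^-1 * (un * vn) by field; lra.
by rewrite /=; lra.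
Qed.

Lemma killed_bounded : exists M : R,
  (forall n, (mean_pos P X y n <= M%:E)%E) /\
  fine (survival P X y n) @[n --> \oo] --> (0 : R).
Proof.
have [/andP[r0 r2] be0] : 0 < r < 2 /\ 0 < r `^ (1 + eps).
  by split=> //; apply: powR_gt0; case/andP: r02.
have pS n : fine (p n.+1) <= fine (p n).
  by rewrite fine_le// survival_noninc.
have uS n : fine (u n) <= fine (u n.+1).
  by rewrite fine_le// mean_pos_nondec.
have p_ge0 n : 0 <= fine (p n) by rewrite fine_ge0// survival_ge0.
have u_ge0 n : 0 <= fine (u n) by rewrite fine_ge0// mean_pos_ge0.
have [n k|n|M [HM Hp]] := @bounded_of_recursion R (fine \o p) (fine \o u) (fine \o v)
  (fine \o m eps) c r (r `^ (1 + eps)) D p_ge0 pS u_ge0 uS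
  (fun n => fine_ge0 (m_ge0 n)) c0 r02 be0 _ _ v_lower m_blocks.
- have rk : 0 < r ^+ k by rewrite exprn_gt0.
  have := mean_pos_step y indep X0 n rk eps0.
  rewrite -/(u n.+1) -/(u n) -/(p n) -/(p n.+1) -/(m eps n).
  rewrite -(fineK (u_fin n)) -(fineK (p_fin n)) -(fineK (mfin n)).
  rewrite -(fineK (u_fin n.+1)) -(fineK (p_fin n.+1)) -!EFinM -!EFinD lee_fin.
  rewrite powR_exprn; last exact: ltW.
  by rewrite [_^-1 * _]mulrC [fine (p n) * _]mulrC mulrAC.
- apply: potential_decay => //.
  + by move=> k; exact: fine_ge0.
  + exact: potential_sum.
  + by rewrite /= /p survival0.
exists M; split => // n.
by rewrite -/(u n) -(fineK (u_fin n)) lee_fin; exact: HM.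
Qed.

End bound.
End killed_chain_bound.

(** * The stopping time *)

Section stopping_time.
Context {R : realType} {d} {Om : measurableType d}.
Variables (X : nat -> {mfun Om >-> measurableTypeR R}) (y : R).
Hypothesis y0 : 0 <= y.

Lemma Sn_recr n o : Sn X n.+1 o = Sn X n o + X n o.
Proof. by rewrite /Sn big_ord_recr. Qed.

Lemma killed_positive n o : (forall k, (0 < k <= n)%N -> 0 < y + Sn X k o) ->
  killed X y n o = y + Sn X n o.
Proof.
elim: n => [|n IH] pos; first by rewrite /Sn big_ord0 addr0.
have pos' k : (0 < k <= n)%N -> 0 < y + Sn X k o.
  by move=> /andP[k0 kn]; apply: pos; rewrite k0 ltnW.
rewrite /= IH// /killed_step -addrA -Sn_recr pos ?leqnn// andbT ifT//.
(* Time 0 is treated apart: positivity is assumed only from time 1 on, and there the living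
   condition is y >= 0. *)
case: n {IH} pos pos' => [|n] pos pos'; first by rewrite /Sn big_ord0 addr0.
by rewrite ltW// pos' ?leqnn.
Qed.

Lemma killed_dead n k o : (0 < k <= n)%N -> y + Sn X k o <= 0 ->
  killed X y n o = -1.
Proof.
elim: n k => [|n IH] k; first by case: k.
move=> /andP[k0]; rewrite leq_eqVlt => /predU1P[->|kn] h /=; last first.
  by rewrite (IH k) ?k0// /killed_step ler0N1.
have [[j jn hj]|nex] := pselect (exists2 j, (0 < j <= n)%N & y + Sn X j o <= 0).
  by rewrite (IH j)// /killed_step ler0N1.
rewrite killed_positive; last first.
  by move=> j jn; rewrite ltNge; apply/negP => hj; apply: nex; exists j.
by rewrite /killed_step -addrA -Sn_recr [_ < _]ltNge h andbF.
Qed.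

Variant tau_spec o : option nat -> Type :=
| TauNone of (forall k, (0 < k)%N -> 0 < y + Sn X k o) : tau_spec o None
| TauSome t of (0 < t)%N & y + Sn X t o <= 0 &
    (forall k, (0 < k < t)%N -> 0 < y + Sn X k o) : tau_spec o (Some t).

Lemma tauP o : tau_spec o (tau X y o).
Proof.
rewrite /tau; case: pselect => [h|h].
  case: ex_minnP => t /andP[t0 ht] tmin; constructor => // k /andP[k0 kt].
  rewrite ltNge; apply/negP => hk.
  by have := tmin k; rewrite k0 hk => /(_ isT); rewrite leqNgt kt.
constructor => k k0; rewrite ltNge; apply/negP => hk.
by apply: h; exists k; rewrite k0.
Qed.

(** Before the first exit the chain equals y + S_n, and afterwards it is -1 forever; so the sign of
    its current value records whether tau has occurred. *)
Lemma tau_gt_alive n o : tau_gt X y n o = (0 <= killed X y n o) :> Prop.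
Proof.
apply/propext; rewrite /tau_gt/=; case: tauP => [pos|t t0 ht pos].
  split=> // _; rewrite killed_positive; last by move=> k /andP[k0 _]; exact: pos.
  by case: n => [|n]; [rewrite /Sn big_ord0 addr0|rewrite ltW// pos].
split=> [nt|]; last first.
  apply: contraTT; rewrite -leqNgt => tn.
  by rewrite (@killed_dead n t) ?t0// ler0N1.
rewrite killed_positive => [|k /andP[k0 kn]]; last first.
  by apply: pos; rewrite k0 (leq_ltn_trans kn).
case: n nt => [|n] nt; first by rewrite /Sn big_ord0 addr0.
by rewrite ltW// pos.
Qed.

Lemma killed_alive n o : 0 <= killed X y n o -> killed X y n o = y + Sn X n o.
Proof.
rewrite -tau_gt_alive /tau_gt/=; case: tauP => [pos _|t t0 ht pos nt].
  by apply: killed_positive => k /andP[k0 _]; exact: pos.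
apply: killed_positive => k /andP[k0 kn]; apply: pos.
by rewrite k0 (leq_ltn_trans kn).
Qed.

Lemma Un_integrandE n o :
  (y + Sn X n o) * \1_(tau_gt X y n) o = Num.max 0 (killed X y n o).
Proof.
rewrite indicE.
have [h|h] := leP 0 (killed X y n o).
  by rewrite mem_set ?tau_gt_alive// mulr1 -killed_alive.
by rewrite memNset ?mulr0// tau_gt_alive leNgt h.
Qed.

(** This is -S_tau on the event tau = k + 1 and 0 elsewhere. Written through the chain, it is
    visibly measurable and matches the integrand of [mean_stopped_step]. *)
Definition stopped_term (k : nat) (o : Om) : R :=
  (0 <= killed X y k o)%R%:R * ((killed X y k o + X k o <= 0)%R%:R *
    (y - (killed X y k o + X k o))).

Lemma stopped_termE k o :
  stopped_term k o = (tau X y o == Some k.+1)%:R * - S_tau X y o.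
Proof.
rewrite /stopped_term.
have [h|h] := leP 0 (killed X y k o); last first.
  rewrite mul0r; case: eqP => tk; last by rewrite mul0r.
  suff : 0 <= killed X y k o by rewrite leNgt h.
  by rewrite -tau_gt_alive /tau_gt/= tk.
rewrite mul1r killed_alive// -addrA -Sn_recr /S_tau.
have : tau_gt X y k o by rewrite tau_gt_alive.
rewrite /tau_gt/=; case: tauP => [pos _|t t0 ht pos kt].
  by rewrite leNgt pos//= !mul0r.
case: eqP => [[tk]|tk]; first by rewrite -tk ht !mul1r opprD addNKr.
rewrite leNgt pos ?mul0r//= ltn_neqAle kt andbT.
by apply/eqP => kt'; apply: tk; rewrite kt'.
Qed.

Lemma S_tau_le0 o : S_tau X y o <= 0.
Proof.
by rewrite /S_tau; case: tauP => // t t0 ht _; rewrite (le_trans _ ht)// lerDr.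
Qed.

Lemma cvg_stopped o :
  \sum_(k < n) stopped_term k o @[n --> \oo] --> - S_tau X y o.
Proof.
apply: (@cvg_trans _ (cst (- S_tau X y o) @ \oo)); last exact: cvg_cst.
apply: near_eq_cvg.
rewrite /S_tau; case E : (tau X y o) => [t|]; last first.
  (* If tau is infinite all terms vanish, in agreement with the default value 0 of [S_tau]. *)
  near=> n; rewrite /= oppr0 big1// => k _; by rewrite stopped_termE E mul0r.
have t0 : (0 < t)%N by move: E; case: tauP => // t' t'0 _ _ [<-].
exists t => //= n tn.
(* The only nonzero term has index t - 1, since term k belongs to tau = k + 1. *)
have tn' : (t.-1 < n)%N by rewrite prednK.
rewrite (bigD1 (Ordinal tn'))//= stopped_termE E prednK// eqxx mul1r.
rewrite big1 ?addr0 => [|k kt]; first by rewrite /S_tau E.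
rewrite stopped_termE E; case: eqP => [[tk]|]; last by rewrite mul0r.
by move: kt; rewrite -val_eqE/= tk eqxx.
Unshelve. all: by end_near. Qed.

End stopping_time.

(** * Optional stopping and passage to the limit *)

Section stopped_mean.
Context {R : realType} {d} {Om : measurableType d} (P : probability Om R).
Variables (X : nat -> {mfun Om >-> measurableTypeR R}) (y : R).
Hypothesis y0 : 0 <= y.

Let mX n : measurable_fun setT (X n : Om -> measurableTypeR R).
Proof. exact: measurable_funPT. Qed.

Let mW n : measurable_fun setT (killed X y n : Om -> measurableTypeR R).
Proof. exact: measurable_killed. Qed.

Let stopped_term_ge0 k o : 0 <= stopped_term X y k o.
Proof. by rewrite mulr_ge0// stop_ge0. Qed.

Let measurable_stopped_term k : measurable_fun setT (stopped_term X y k).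
Proof.
have ms : measurable_fun setT (fun o => killed X y k o + X k o).
  by apply: measurable_funD; [exact: mW|exact: mX].
apply: measurable_funM.
  by apply: measurable_fun_natb; apply: measurable_fun_ler => //; exact: mW.
apply: measurable_funM; last exact: measurable_funB.
by apply: measurable_fun_natb; exact: measurable_fun_ler.
Qed.

Lemma measurable_S_tau : measurable_fun setT (S_tau X y).
Proof.
rewrite (_ : S_tau X y = \- (fun o => - S_tau X y o)); last first.
  by apply/funext => o /=; rewrite opprK.
apply: measurable_funN.
apply: (@measurable_fun_cvg _ _ _ _ (fun n o => \sum_(k < n) stopped_term X y k o)).
  by move=> n; exact: measurable_sum.
by move=> o _; exact: cvg_stopped.
Qed.

Local Open Scope ereal_scope.

Lemma UnE (Q : {mfun env R >-> pprobability Om R}) n e :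
  Un Q X n e y = mean_pos (quenched Q e) X y n.
Proof.
rewrite /Un expectation.unlock; apply: eq_integral => o _.
by rewrite Un_integrandE.
Qed.

Hypothesis indep : mutually_independent P X.
Hypothesis X0 : forall n, centered_law (distribution P (X n)).
Variable M : R.
Hypothesis uM : forall n, mean_pos P X y n <= M%:E.
Hypothesis p0 : fine (survival P X y n) @[n --> \oo] --> (0 : R)%R.

Let u n := mean_pos P X y n.
Let p n := survival P X y n.

Let u_fin n : u n \is a fin_num.
Proof. by rewrite ge0_fin_numE ?mean_pos_ge0// (le_lt_trans (uM n))// ltry. Qed.

Let p_fin n : p n \is a fin_num.
Proof. exact: survival_fin_num. Qed.

Let partial n := \int[P]_o (\sum_(k < n) stopped_term X y k o)%:E.

(** Optional stopping at the minimum of tau and n, by summing [mean_stopped_step]. The bound M makes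
    every term finite, which permits cancellation. *)
Let partialE n : partial n + y%:E * p n = u n.
Proof.
elim: n => [|n IH].
  rewrite /partial /u /p survival0// mean_pos0// mule1 integral0_eq ?add0e//.
  by move=> o _; rewrite big_ord0.
have -> : partial n.+1 = partial n + \int[P]_o (stopped_term X y n o)%:E.
  rewrite -ge0_integralD_EFin//; last 2 first.
  - exact: measurable_sum.
  - by move=> o; exact: sumr_ge0.
  by apply: eq_integral => o _; rewrite big_ord_recr.
have := mean_stopped_step indep X0 y0 n.
set s := \int[P]_o _ => sE; rewrite -[X in _ + X + _]/s.
rewrite -/(u n) -/(u n.+1) -/(p n) -/(p n.+1) in sE.
have s0 : 0 <= s by apply: integral_ge0 => o _; rewrite lee_fin stopped_term_ge0.
have ufn := u_fin n; have ufS := u_fin n.+1.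
have pfn := p_fin n; have pfS := p_fin n.+1.
have i0 : 0 <= partial n.
  by apply: integral_ge0 => o _; rewrite lee_fin sumr_ge0.
have ifin : partial n \is a fin_num.
  rewrite ge0_fin_numE// (@le_lt_trans _ _ (u n))//; last first.
    by rewrite -ge0_fin_numE ?mean_pos_ge0.
  by rewrite -IH leeDl// mule_ge0 ?lee_fin// survival_ge0.
have sfin : s \is a fin_num.
  rewrite ge0_fin_numE// (@le_lt_trans _ _ (u n.+1 + y%:E * p n))//.
    rewrite -sE -addeA leeDl// adde_ge0 ?mean_pos_ge0//.
    by rewrite mule_ge0 ?lee_fin// survival_ge0.
  by rewrite -(fineK ufS) -(fineK pfn) -EFinM -EFinD ltry.
move: IH sE; rewrite -(fineK ufn) -(fineK ufS) -(fineK pfn) -(fineK pfS).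
rewrite -(fineK ifin) -(fineK sfin) -!EFinM -!EFinD => -[IH] -[sE].
by congr EFin; lra.
Qed.

(** Monotone convergence handles [partial n], and y p_n tends to 0, so u_n has the same limit; the
    bound M on u_n makes it finite. *)
Lemma stopped_mean_cvg : exists l : R,
  \int[P]_o (- S_tau X y o)%:E = l%:E /\ mean_pos P X y n @[n --> \oo] --> l%:E.
Proof.
have cI : partial n @[n --> \oo] --> \int[P]_o (- S_tau X y o)%:E.
  have -> : \int[P]_o (- S_tau X y o)%:E =
      \int[P]_o limn (fun n => (\sum_(k < n) stopped_term X y k o)%:E).
    apply: eq_integral => o _; apply/esym/cvg_lim => //.
    by apply: cvg_EFin; [exact: nearW|exact: cvg_stopped].
  apply: cvg_monotone_convergence => //.
  - by move=> n; apply/measurable_EFinP; exact: measurable_sum.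
  - by move=> n o _; rewrite lee_fin sumr_ge0.
  move=> o _; apply/nondecreasing_seqP => n.
  by rewrite lee_fin big_ord_recr lerDl.
have cp : y%:E * p n @[n --> \oo] --> 0.
  rewrite -[X in _ --> X](mule0 y%:E); apply: cvgeZl => //.
  by apply: cvg_EFin => //; exact: nearW.
have cu : u n @[n --> \oo] --> \int[P]_o (- S_tau X y o)%:E.
  rewrite -[X in _ --> X]adde0.
  rewrite (_ : u = fun n => partial n + y%:E * p n); last first.
    by apply/funext => n; rewrite partialE.
  by apply: cvgeD => //; rewrite fin_num_adde_defl.
have S0 : 0 <= \int[P]_o (- S_tau X y o)%:E.
  by apply: integral_ge0 => o _; rewrite lee_fin oppr_ge0 S_tau_le0.
exists (fine (\int[P]_o (- S_tau X y o)%:E)); rewrite fineK//.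
rewrite ge0_fin_numE// (@le_lt_trans _ _ M%:E) ?ltry//.
by apply: (cvge_to_le cu); exact: nearW.
Qed.

Lemma ae_tau_finite : {ae P, forall o, tau X y o != None}.
Proof.
pose A := \bigcap_n [set o | (0 <= killed X y n o)%R].
have mAn n : measurable [set o | (0 <= killed X y n o)%R].
  rewrite -[X in measurable X]setTI.
  by apply: measurable_fun_ler => //; exact: mW.
have mA : measurable A by exact: bigcapT_measurable.
exists A; split => //; last first.
  move=> o /= /negP; rewrite negbK => /eqP h n _ /=.
  by rewrite -tau_gt_alive /tau_gt/= ?h.
have PA n : P A <= p n.
  rewrite -[X in P X]setIT -integral_indic//.
  apply: ge0_le_integral_EFin => //.
  - by apply: measurable_fun_natb; apply: measurable_fun_ler => //; exact: mW.
  - move=> o; rewrite indicE; have [|//] := boolP (o \in A).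
    by move=> /set_mem/(_ n I) /= ->.
apply/eqP; rewrite eq_le measure_ge0 andbT.
have cp : p n @[n --> \oo] --> 0 by apply: cvg_EFin => //; exact: nearW.
by apply: (cvge_to_ge cp); exact: nearW.
Qed.

End stopped_mean.

(** * Maximal ergodic inequality *)

Lemma integral_cst_EFin {R : realType} {d} {T : measurableType d}
  (mu : probability T R) (k : R) : (\int[mu]_x (cst k x)%:E = k%:E)%E.
Proof.
by rewrite -[RHS]mule1 -(@probability_setT _ _ _ mu) -integral_cst.
Qed.

Section measure_preserving.
Context {R : realType} {d} {T : measurableType d} (mu : probability T R).
Variable theta : T -> T.
Hypothesis mtheta : measurable_fun setT theta.
Hypothesis preserving : forall A, measurable A -> mu (theta @^-1` A) = mu A.

Lemma preserving_integral (f : T -> \bar R) : measurable_fun setT f ->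
  (forall x, 0 <= f x)%E -> (\int[mu]_x f (theta x) = \int[mu]_x f x)%E.
Proof.
move=> mf f0; transitivity (\int[pushforward mu theta]_x f x)%E.
  by rewrite ge0_integral_pushforward.
by apply: eq_measure_integral => A mA _; exact: preserving.
Qed.

Lemma measurable_iter k : measurable_fun setT (iter k theta).
Proof.
elim: k => [|k IH]; first exact: measurable_id.
exact: (measurableT_comp mtheta IH).
Qed.

Lemma preserving_integral_iter k (f : T -> \bar R) : measurable_fun setT f ->
  (forall x, 0 <= f x)%E -> (\int[mu]_x f (iter k theta x) = \int[mu]_x f x)%E.
Proof.
move=> mf f0; elim: k => [//|k IH]; rewrite -[RHS]IH.
under eq_integral do rewrite iterSr.
apply: (@preserving_integral (f \o iter k theta)); last by move=> x; exact: f0.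
exact: (measurableT_comp mf (measurable_iter k)).
Qed.

Lemma preserving_iter k (A : set T) : measurable A ->
  mu (iter k theta @^-1` A) = mu A.
Proof.
move=> mA; elim: k => [//|k <-].
have mkA : measurable (iter k theta @^-1` A).
  by rewrite -[X in measurable X]setTI; exact: measurable_iter.
rewrite -(preserving mkA); congr (mu _).
by apply/funext => x; rewrite /preimage /mkset iterSr.
Qed.

Lemma ae_preserving_iter (A : set T) : measurable A -> {ae mu, forall x, A x} ->
  {ae mu, forall x, forall k, A (iter k theta x)}.
Proof.
move=> mA aeA; apply: ae_foralln => k.
have mkA : measurable (iter k theta @^-1` ~` A).
  by rewrite -[X in measurable X]setTI; apply: measurable_iter => //; exact: measurableC.
exists (iter k theta @^-1` ~` A); split => //.
transitivity (mu (~` A)); first by apply: preserving_iter; exact: measurableC.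
by apply/negligibleP => //; exact: measurableC.
Qed.

(** A block has 3 * 4^j terms of equal mean, so the weighted j-th block has mean 3 (2/b)^j times the
    integral of f. This is summable for b > 2, and a nonnegative series of finite mean is almost
    surely finite. *)
Lemma ae_blocks_finite (f : T -> \bar R) (b : R) : measurable_fun setT f ->
  (forall x, 0 <= f x)%E -> (\int[mu]_x f x < +oo)%E -> 2 < b ->
  {ae mu, forall x, (\sum_(0 <= j <oo) (((2 * b) ^+ j)^-1)%:E *
    \sum_(4 ^ j <= k < 4 ^ j.+1) f (iter k theta x) < +oo)%E}.
Proof.
have alg (c t a : R) : t != 0 -> a != 0 ->
    (t * a)^-1 * (c * (3 * (t * t))) = c * 3 * (t / a).
  by move=> t0 a0; field; rewrite t0 a0.
move=> mf f0 intf b2.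
have bn0 : b != 0 by rewrite gt_eqF//; lra.
have q01 : 0 <= 2 / b < 1.
  by rewrite divr_ge0/=; [rewrite ltr_pdivrMr; lra|lra|lra].
have mfi k : measurable_fun setT (fun x => f (iter k theta x)).
  exact: (measurableT_comp mf (measurable_iter k)).
pose w j : R := ((2 * b) ^+ j)^-1.
have w0 j : 0 <= w j by rewrite invr_ge0 exprn_ge0//; lra.
pose h j x := ((w j)%:E * \sum_(4 ^ j <= k < 4 ^ j.+1) f (iter k theta x))%E.
have h0 j x : (0 <= h j x)%E by rewrite mule_ge0 ?lee_fin// sume_ge0.
have mh j : measurable_fun setT (h j).
  by apply: measurable_funeM; exact: emeasurable_sum.
pose c := fine (\int[mu]_x f x)%E.
have c0 : 0 <= c by rewrite fine_ge0// integral_ge0.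
have cE : (\int[mu]_x f x)%E = c%:E.
  by rewrite fineK// ge0_fin_numE// integral_ge0.
have ih j : (\int[mu]_x h j x)%E = (c * 3 * (2 / b) ^+ j)%:E.
  rewrite ge0_integralZl ?lee_fin//; last 2 first.
  - exact: emeasurable_sum.
  - by move=> x _; exact: sume_ge0.
  rewrite ge0_integral_sum//.
  under eq_bigr do rewrite preserving_integral_iter// cE.
  rewrite sumEFin sumr_const_nat -EFinM; congr EFin.
  rewrite (_ : (4 ^ j.+1 - 4 ^ j = 3 * 4 ^ j)%N); last by rewrite expnS; lia.
  rewrite -[c *+ _]mulr_natr natrM natrX /w expr_div_n exprMn.
  rewrite (_ : 4 = 2 * 2 :> R) ?exprMn; last by ring.
  by apply: alg; rewrite expf_neq0.
have ish : mu.-integrable setT (fun x => \sum_(0 <= j <oo) h j x)%E.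
  apply/integrableP; split; first exact: ge0_emeasurable_sum.
  under eq_integral do rewrite gee0_abs ?nneseries_ge0//.
  rewrite integral_nneseries//.
  apply: (@le_lt_trans _ _ (c * 3 * (1 - 2 / b)^-1)%:E); last exact: ltry.
  apply: lime_le; first by apply: is_cvg_nneseries => j _ _; exact: integral_ge0.
  apply: nearW => n; under eq_bigr do rewrite ih.
  rewrite sumEFin lee_fin -mulr_sumr big_mkord ler_wpM2l ?mulr_ge0//.
  exact: geometric_sum_le.
have := integrable_ae measurableT ish; apply: filterS => x /(_ I).
by rewrite ge0_fin_numE// nneseries_ge0.
Qed.

Section averages.
Variable g : T -> R.
Hypothesis mg : measurable_fun setT g.
Hypothesis g01 : forall x, 0 <= g x <= 1.

(** The maximum over 0 <= k <= n of the sums of c - g(theta^i x) for i < k, in the recursive form on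
    which Garsia's argument rests. *)
Fixpoint running_max (c : R) (n : nat) (x : T) : R :=
  if n is m.+1 then Num.max 0 (c - g x + running_max c m (theta x)) else 0.

Lemma running_max_ge0 c n x : 0 <= running_max c n x.
Proof. by case: n => //= n; rewrite le_max lexx. Qed.

Lemma running_max_nondec c n x : running_max c n x <= running_max c n.+1 x.
Proof.
elim: n x => [|n IH] x; first exact: running_max_ge0.
rewrite -[leRHS]/(Num.max 0 (c - g x + running_max c n.+1 (theta x))).
by rewrite /= le_max2// lerD2l.
Qed.

Lemma running_max_le c n x : 0 <= c -> running_max c n x <= c * n%:R.
Proof.
move=> c0; elim: n x => [|n IH] x; first by rewrite mulr0.
rewrite /= ge_max mulr_ge0//= -natr1 mulrDr mulr1 addrC lerD//.
by have /andP[] := g01 x; lra.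
Qed.

Lemma running_max_lower c n k x : (k <= n)%N ->
  c * k%:R - \sum_(i < k) g (iter i theta x) <= running_max c n x.
Proof.
elim: n k x => [|n IH] [|k] x //; rewrite ?big_ord0 ?mulr0 ?subr0//.
  by move=> _; exact: running_max_ge0.
rewrite ltnS => kn; rewrite big_ord_recl/= le_max; apply/orP; right.
have := IH k (theta x) kn; rewrite -natr1 mulrDr mulr1.
have -> : \sum_(i < k) g (iter i theta (theta x)) =
    \sum_(i < k) g (iter (lift ord0 i) theta x).
  by apply: eq_bigr => i _; rewrite -iterSr.
by lra.
Qed.

Lemma measurable_running_max c n : measurable_fun setT (running_max c n).
Proof.
elim: n => [|n IH] /=; first exact: measurable_cst.
apply: measurable_maxr => //; apply: measurable_funD; first exact: measurable_funB.
exact: (measurableT_comp IH mtheta).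
Qed.

Local Open Scope ereal_scope.

(* Garsia's argument: M = running_max satisfies M <= (c - g) 1_{M > 0} + M o theta *)
Lemma maximal_inequality c n : (0 <= c)%R ->
  \int[mu]_x (g x * (0 < running_max c n x)%R%:R)%:E <= c%:E.
Proof.
move=> c0.
pose B x : R := (0 < running_max c n x)%R%:R.
have mM := measurable_running_max c n.
have M0 := running_max_ge0 c n.
have mB : measurable_fun setT B.
  by apply: measurable_fun_natb; exact: measurable_fun_ltr.
have B0 x : (0 <= B x)%R by [].
have g0 x : (0 <= g x)%R by have /andP[] := g01 x.
have gB0 x : (0 <= g x * B x)%R by rewrite mulr_ge0.
have mgB : measurable_fun setT (fun x => g x * B x)%R by exact: measurable_funM.
have fin : \int[mu]_x (running_max c n x)%:E \is a fin_num.
  rewrite ge0_fin_numE; last by apply: integral_ge0 => x _; rewrite lee_fin.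
  apply: (@le_lt_trans _ _ (\int[mu]_x (cst (c * n%:R)%R x)%:E)).
    by apply: ge0_le_integral_EFin => // x; exact: running_max_le.
  by rewrite integral_cst_EFin ltry.
(* Add the finite integral of M to both sides, and on the right replace it by that of M o theta; a
   pointwise inequality remains. *)
rewrite -(leeD2rE _ _ fin) -ge0_integralD_EFin//.
rewrite -(preserving_integral (f := EFin \o running_max c n)); last 2 first.
- exact/measurable_EFinP.
- by move=> x; rewrite lee_fin.
have mMt : measurable_fun setT (fun x => running_max c n (theta x)).
  exact: (measurableT_comp mM mtheta).
apply: (@le_trans _ _ (\int[mu]_x (cst c x + running_max c n (theta x))%:E)).
  apply: ge0_le_integral_EFin => //.
  - exact: measurable_funD.
  - exact: measurable_funD.
  - by move=> x; rewrite addr_ge0.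
  move=> x; rewrite /B /=.
  case: n M0 {fin mM B mB B0 gB0 mgB mMt} => [|n] M0.
    by rewrite /= ltxx mulr0 !addr0.
  have [h|h] := ltP 0%R (running_max c n.+1 x); last first.
    by rewrite mulr0 add0r (le_trans h)// addr_ge0.
  rewrite mulr1 -lerBrDl.
  have := running_max_nondec c n (theta x).
  move: h => /=; case: (leP 0%R (c - g x + running_max c n (theta x))%R) => h1 h2 h3.
    by lra.
  by rewrite ltxx in h2.
by rewrite ge0_integralD_EFin// integral_cst_EFin.
Qed.

(** Let B be the set where, for every c = 1/(j+1), some running maximum is positive. The maximal
    inequality bounds the integral of g over B by each such c, so it is 0 and B is null because g >
    0. Off B some c makes all running maxima vanish, which is the claimed lower bound. *)
Lemma ae_average_lower : {ae mu, forall x, (0 < g x)%R} ->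
  {ae mu, forall x, exists2 c : R, (0 < c)%R &
    forall n, (c * n%:R <= \sum_(k < n) g (iter k theta x))%R}.
Proof.
move=> g_gt0.
have g0 x : (0 <= g x)%R by have /andP[] := g01 x.
have mb c n : measurable_fun setT (fun x => (0 < running_max c n x)%R).
  by apply: measurable_fun_ltr => //; exact: measurable_running_max.
have mB c n : measurable [set x | (0 < running_max c n x)%R].
  by rewrite -[X in measurable X]setTI; exact: mb.
pose bad (j : nat) := \bigcup_n [set x | (0 < running_max j.+1%:R^-1 n x)%R].
have mbad j : measurable (bad j) by exact: bigcupT_measurable.
pose B := \bigcap_j bad j.
have mBad : measurable B by exact: bigcapT_measurable.
have mgB : measurable_fun setT (fun x => g x * \1_B x)%R by exact: measurable_funM.
(* The events of positive running maximum increase with n to [bad j], which contains B; monotone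
   convergence passes the maximal inequality to the union. *)
have gB_le j : \int[mu]_x (g x * \1_B x)%:E <= (j.+1%:R^-1)%:E.
  pose f n x := (g x * (0 < running_max j.+1%:R^-1 n x)%R%:R)%:E.
  have f0 n x : 0 <= f n x by rewrite lee_fin mulr_ge0.
  have mf n : measurable_fun setT (f n).
    by apply/measurable_EFinP; apply: measurable_funM => //; exact: measurable_fun_natb.
  have ndf x : {homo f ^~ x : n m / (n <= m)%N >-> n <= m}.
    apply/nondecreasing_seqP => n; rewrite lee_fin ler_wpM2l// ler_nat.
    have [h|//] := ltP 0%R (running_max j.+1%:R^-1 n x).
    by rewrite (lt_le_trans h)// running_max_nondec.
  apply: (@le_trans _ _ (\int[mu]_x limn (f ^~ x))).
    apply: ge0_le_integral => //.
    - by move=> x _; rewrite lee_fin mulr_ge0.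
    - exact/measurable_EFinP.
    - by apply: (emeasurable_fun_cvg f) => // x _; exact: ereal_nondecreasing_is_cvgn.
    move=> x _; rewrite indicE; have [xB|_] := boolP (x \in B); last first.
      rewrite mulr0; apply: lime_ge; last by exact: nearW.
      exact: ereal_nondecreasing_is_cvgn.
    have [n _ hn] := set_mem xB j I.
    rewrite mulr1; apply: (@le_trans _ _ (f n x)); first by rewrite /f hn mulr1.
    apply: lime_ge; first exact: ereal_nondecreasing_is_cvgn.
    by exists n => // k; exact: ndf.
  rewrite (monotone_convergence mu measurableT mf) => [|n x _|x _]; [|exact: f0|exact: ndf].
  apply: lime_le; last by apply: nearW => n; apply: maximal_inequality; rewrite invr_ge0.
  apply: ereal_nondecreasing_is_cvgn; apply/nondecreasing_seqP => n.
  by apply: ge0_le_integral => // x _; apply: ndf.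
have gB_0 : \int[mu]_x (g x * \1_B x)%:E = 0.
  apply/eqP; rewrite eq_le; apply/andP; split; last first.
    by apply: integral_ge0 => x _; rewrite lee_fin mulr_ge0.
  apply/lee_addgt0Pr => e e0; rewrite add0e.
  have [j _ /(_ j (leqnn _))] : \forall j \near \oo, (j.+1%:R^-1 < e)%R.
    exact: near_infty_natSinv_lt (PosNum e0).
  by move=> je; rewrite (le_trans (gB_le j))// lee_fin ltW.
have : ae_eq mu setT (fun x => (g x * \1_B x)%:E) (cst 0).
  apply/ae_eq_integral_abs => //; first exact/measurable_EFinP.
  by under eq_integral do rewrite gee0_abs ?lee_fin ?mulr_ge0//.
move=> gB_ae; near=> x.
have gx : (0 < g x)%R by near: x.
have : (g x * \1_B x)%:E = 0 by near: x; apply: filterS gB_ae => x; exact.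
move=> -[] /eqP; rewrite mulf_eq0 gt_eqF//= indicE pnatr_eq0 eqb0 => xB.
have /existsNP[j /not_implyP[_ xj]] : ~ B x by move=> Bx; rewrite mem_set in xB.
exists j.+1%:R^-1%R => // n.
have : ~~ (0 < running_max j.+1%:R^-1 n x)%R.
  by apply/negP => h; apply: xj; exists n.
rewrite -leNgt => h; rewrite -subr_le0; apply: le_trans h.
exact: running_max_lower (leqnn n).
Unshelve. all: by end_near. Qed.

End averages.
End measure_preserving.

(** * Environments *)

Section environment_law.
Context {R : realType} {dE : measure_display} {OE : measurableType dE}.
Variables (P : probability OE R) (xi : nat -> {mfun OE >-> law R}).

Lemma measurable_coordinate n : measurable_fun setT (fun e : env R => e n : law R).
Proof.
move=> _ B mB; apply: sub_sigma_algebra; exists n => //.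
by exists B.
Qed.

Lemma measurable_to_env {d} {T : measurableType d} (f : T -> env R) :
  (forall n, measurable_fun setT (fun x => f x n : law R)) -> measurable_fun setT f.
Proof.
move=> mf; apply: (measurability (@cylinders R : set (set (env R)))) => //.
move=> _ [_ [n _ [B mB <-]] <-]; rewrite setTI setTI.
by rewrite -[X in measurable X]setTI; exact: mf.
Qed.

Lemma measurable_shift : measurable_fun setT (@Defs.shift R : env R -> env R).
Proof. by apply: measurable_to_env => n; exact: measurable_coordinate. Qed.

Lemma measurable_env_of : measurable_fun setT (env_of xi : OE -> env R).
Proof. by apply: measurable_to_env => n; exact: measurable_funPT. Qed.

Definition env_mfun : {mfun OE >-> env R} :=
  HB.pack (env_of xi : OE -> env R)
    (isMeasurableFun.Build _ _ _ (env R) (env_of xi) measurable_env_of).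

(** Ergodic arguments are run on the space of sequences, where the shift acts; the original space
    carries no transformation. *)
Definition env_law : probability (env R) R := distribution P env_mfun.

Lemma iter_shift k (e : env R) n : iter k (@Defs.shift R) e n = e (k + n)%N.
Proof. by elim: k e n => [//|k IH] e n; rewrite iterSr IH addSn. Qed.

Lemma ae_env_law (A : env R -> Prop) :
  {ae env_law, forall e, A e} -> {ae P, forall w, A (env_of xi w)}.
Proof.
move=> [N [mN PN AN]]; exists (env_of xi @^-1` N); split.
- by rewrite -[X in measurable X]setTI; exact: measurable_env_of.
- exact: PN.
- by move=> w /= nA; exact: (AN (env_of xi w)).
Qed.

Lemma env_law_ae (A : set (env R)) : measurable A ->
  {ae P, forall w, A (env_of xi w)} -> {ae env_law, forall e, A e}.
Proof.
move=> mA aeA; exists (~` A); split => //; first exact: measurableC.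
have mC : measurable (env_of xi @^-1` ~` A).
  by rewrite -[X in measurable X]setTI; apply: measurable_env_of => //; exact: measurableC.
change (P (env_of xi @^-1` ~` A) = 0%E).
by apply/negligibleP => //; exact: aeA.
Qed.

End environment_law.

(** * Reduction of the k-th increment to the first one by shifting the environment *)

Section quenched_law.
Context {R : realType} {d : measure_display} {Om : measurableType d}.
Variables (X : nat -> {mfun Om >-> measurableTypeR R})
  (Q : {mfun env R >-> pprobability Om R}).
Hypothesis model : quenched_model Q X.
Local Open Scope ereal_scope.

Lemma measurable_quenched_integral (f : Om -> \bar R) : measurable_fun setT f ->
  (forall o, 0 <= f o) ->
  measurable_fun setT (fun e : env R => \int[quenched Q e]_o f o).
Proof.
move=> mf f0; apply: (measurable_fun_integral_kernel
  (l := fun e : env R => (quenched Q e : {measure set Om -> \bar R}))) => //.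
move=> U mU.
have mQ : measurable_fun setT Q by exact: measurable_funPT.
exact: (measurable_kernel (kprobability mQ) U mU).
Qed.

(** Both sides are the law [e k], which is the first entry of the environment shifted k times. *)
Lemma quenched_distribution (e : env R) k (A : set (measurableTypeR R)) :
  measurable A -> distribution (quenched Q e) (X k) A =
    distribution (quenched Q (iter k (@Defs.shift R) e)) (X 0) A.
Proof.
move=> mA; have [_ ->//] := model e.
by have [_ ->//] := model (iter k (@Defs.shift R) e); rewrite iter_shift addn0.
Qed.

Lemma quenched_integral_iter (e : env R) k (f : measurableTypeR R -> R) :
  measurable_fun setT f -> (forall x, 0 <= f x)%R ->
  \int[quenched Q e]_o (f (X k o))%:E =
  \int[quenched Q (iter k (@Defs.shift R) e)]_o (f (X 0 o))%:E.
Proof.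
move=> mf f0.
have mEf : measurable_fun setT (EFin \o f) by exact/measurable_EFinP.
have Ef0 x : 0 <= (EFin \o f) x by rewrite lee_fin.
transitivity (\int[distribution (quenched Q e) (X k)]_x (EFin \o f) x).
  by rewrite ge0_integral_distribution.
transitivity (\int[distribution (quenched Q (iter k (@Defs.shift R) e)) (X 0)]_x
    (EFin \o f) x).
  by apply: eq_measure_integral => A mA _; exact: quenched_distribution.
by rewrite ge0_integral_distribution.
Qed.

Lemma quenched_centered (e : env R) (eps : R) k : (0 < eps)%R ->
  \int[quenched Q (iter k (@Defs.shift R) e)]_o (`|X 0 o| `^ (2 + eps))%:E < +oo ->
  'E_(quenched Q (iter k (@Defs.shift R) e))[X 0] = 0 ->
  centered_law (distribution (quenched Q e) (X k)).
Proof.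
set e' := iter k _ e => eps0 me0 Ee0.
have mabs : measurable_fun setT (fun x : measurableTypeR R => `|x|%R).
  exact: measurableT_comp.
have mp := @measurable_normr_powR R (2 + eps).
have mX0 : measurable_fun setT (X 0 : Om -> measurableTypeR R).
  exact: measurable_funPT.
have int0 : (quenched Q e').-integrable setT (EFin \o X 0).
  apply/integrableP; split; first exact/measurable_EFinP.
  (* Integrability follows from |x| <= 1 + |x|^(2+eps). *)
  apply: (@le_lt_trans _ _ (\int[quenched Q e']_o (cst 1%R o + `|X 0 o| `^ (2 + eps))%:E)).
    apply: (@ge0_le_integral_EFin _ _ _ _ (fun o => `|X 0 o|%R)) => //.
    - exact: (measurableT_comp mabs mX0).
    - apply: measurable_funD => //; exact: (measurableT_comp mp mX0).
    move=> o; have [h|h] := leP `|X 0 o|%R 1%R.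
      by rewrite (le_trans h)// lerDl powR_ge0.
    apply: (@le_trans _ _ (`|X 0 o| `^ (2 + eps))%R); last by rewrite lerDr.
    rewrite -[leLHS]powRr1//; apply: ler_powR; [exact: ltW|lra].
  rewrite ge0_integralD_EFin//; last exact: (measurableT_comp mp mX0).
  by rewrite integral_cst_EFin lte_add_pinfty// ltry.
have dE : forall A : set (measurableTypeR R), measurable A -> A `<=` setT ->
    distribution (quenched Q e) (X k) A = distribution (quenched Q e') (X 0) A.
  by move=> A mA _; exact: quenched_distribution.
split.
  apply/integrableP; split; first by apply/measurable_EFinP; exact: measurable_id.
  rewrite (eq_measure_integral _ dE) ge0_integral_distribution//.
    by have /integrableP[] := int0.
  by apply: measurableT_comp => //; apply/measurable_EFinP; exact: measurable_id.
rewrite (eq_measure_integral _ dE) integral_distribution//.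
by rewrite -Ee0 expectation.unlock.
Qed.

End quenched_law.

(** * Choice of the level ratio and assembly of the theorem *)

Lemma exponent_between {R : realType} (eps : R) : 0 < eps ->
  exists2 r : R, 0 < r < 2 & 2 < r `^ (1 + eps).
Proof.
move=> e0; have e20 : 0 < 1 + eps / 2 by lra.
have lt2 (s t : R) : s < t -> 2 `^ s < 2 `^ t.
  move=> st; rewrite /powR pnatr_eq0/= ltr_expR ltr_pM2r//.
  by rewrite ln_gt0// ltr1n.
(* An exponent strictly between 1/(1+eps) and 1 puts r below 2 and r^(1+eps) above 2. *)
exists (2 `^ (1 + eps / 2)^-1).
  rewrite powR_gt0//= -[ltRHS]powRr1//; apply: lt2.
  by rewrite invf_lt1//; lra.
rewrite -powRrM -[ltLHS]powRr1//; apply: lt2.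
by rewrite mulrC ltr_pdivlMr// mul1r; lra.
Qed.

Lemma nneseries_block_bound {R : realType} (f : nat -> \bar R) (b : R) : 0 < b ->
  (forall k, 0 <= f k < +oo)%E ->
  (\sum_(0 <= j <oo) (((2 * b) ^+ j)^-1)%:E * \sum_(4 ^ j <= k < 4 ^ j.+1) f k
    < +oo)%E ->
  exists D, forall J, \sum_(j < J)
    (\sum_(4 ^ j <= k < 4 ^ j.+1) fine (f k)) / (2 * b) ^+ j <= D.
Proof.
move=> b0 f0; set S := (\sum_(0 <= _ <oo) _)%E => Sfin.
have ffin k : f k \is a fin_num by have /andP[h1 h2] := f0 k; rewrite ge0_fin_numE.
have t0 j : (0 <= (((2 * b) ^+ j)^-1)%:E * \sum_(4 ^ j <= k < 4 ^ j.+1) f k)%E.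
  apply: mule_ge0; last by apply: sume_ge0 => k _; have /andP[] := f0 k.
  by rewrite lee_fin invr_ge0 exprn_ge0// mulr_ge0// ltW.
have S0 : (0 <= S)%E by apply: nneseries_ge0 => j _ _; exact: t0.
exists (fine S) => J; rewrite -lee_fin fineK ?ge0_fin_numE//.
apply: le_trans (nneseries_lim_ge J (fun j _ _ => t0 j)).
rewrite big_mkord -sumEFin; apply: lee_sum => j _.
rewrite mulrC EFinM; apply: lee_wpmul2l.
  by rewrite lee_fin invr_ge0 exprn_ge0// mulr_ge0// ltW.
rewrite -sumEFin; apply: lee_sum => k _.
by rewrite fineK.
Qed.

Theorem proposition1p1 (R : realType)
    (dE : measure_display) (OE : measurableType dE) (P : probability OE R)
    (xi : nat -> {mfun OE >-> law R})
    (d : measure_display) (Om : measurableType d)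
    (X : nat -> {mfun Om >-> measurableTypeR R})
    (Q : {mfun env R >-> pprobability Om R})
    (stat : stationary P xi) (erg : ergodic P xi)
    (model : quenched_model Q X)
    (centered : {ae P, forall w, ('E_(quenched Q (env_of xi w))[X 0%N] = 0)%E})
    (moment : exists2 eps : R, 0 < eps &
      (annealed_expectation P xi Q
         (fun _ o => (`|X 0%N o| `^ (2 + eps))%:E) < +oo)%E)
    (positive : {ae P, forall w,
      (0 < quenched Q (env_of xi w) [set o | (0 < X 0%N o)%R])%E})
    (y : R) (y0 : 0 <= y) :
  exists U : env R -> R, measurable_fun setT U /\
    {ae P, forall w, let e := env_of xi w in
      [/\ {ae quenched Q e, forall o, tau X y o != None},
          ((U e)%:E = - 'E_(quenched Q e)[S_tau X y])%E &
          Un Q X n e y @[n --> \oo] --> (U e)%:E]}.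
Proof.
have [eps eps0 meps] := moment.
have [r r02 b2] := exponent_between eps0.
set b := r `^ (1 + eps) in b2.
have mX0 : measurable_fun setT (X 0%N : Om -> measurableTypeR R).
  exact: measurable_funPT.
have mS : measurable_fun setT (fun o => (- S_tau X y o)%:E).
  apply/measurable_EFinP; apply: measurable_funN; exact: measurable_S_tau.
have S0 o : (0 <= (- S_tau X y o)%:E)%E by rewrite lee_fin oppr_ge0 S_tau_le0.
(* [fine] returns 0 where the integral is infinite, which happens only for a null set of
   environments. *)
exists (fun e => fine (\int[quenched Q e]_o (- S_tau X y o)%:E)%E); split.
  apply: (measurableT_comp (@fine_measurable R setT measurableT)).
  exact: measurable_quenched_integral.
pose mu := env_law P xi.
have pres A : measurable A -> mu (@Defs.shift R @^-1` A) = mu A by exact: stat.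
have mshift := @measurable_shift R.
have mp := @measurable_normr_powR R (2 + eps).
have mmin : measurable_fun setT (fun x : measurableTypeR R => Num.min (x ^+ 2) 1).
  by apply: measurable_minr => //; exact: measurable_funX.
have min0 (x : R) : 0 <= Num.min (x ^+ 2) 1 by rewrite le_min sqr_ge0 ler01.
pose m e := (\int[quenched Q e]_o (`|X 0%N o| `^ (2 + eps))%:E)%E.
pose g e := fine (\int[quenched Q e]_o (Num.min (X 0%N o ^+ 2) 1)%:E)%E.
have m0 e : (0 <= m e)%E.
  by apply: integral_ge0 => o _; rewrite lee_fin powR_ge0.
have mm : measurable_fun setT m.
  apply: measurable_quenched_integral => [|o]; last by rewrite lee_fin powR_ge0.
  by apply/measurable_EFinP; exact: (measurableT_comp mp mX0).
have mEmin : measurable_fun setT (fun o => (Num.min (X 0%N o ^+ 2) 1)%:E).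
  by apply/measurable_EFinP; exact: (measurableT_comp mmin mX0).
have mg : measurable_fun setT g.
  apply: (measurableT_comp (@fine_measurable R setT measurableT)).
  by apply: measurable_quenched_integral => // o; rewrite lee_fin.
have gE e : (\int[quenched Q e]_o (Num.min (X 0%N o ^+ 2) 1)%:E <= 1)%E.
  rewrite -(integral_cst_EFin (quenched Q e) 1).
  apply: ge0_le_integral_EFin => //.
    exact: (measurableT_comp mmin mX0).
  by move=> o; rewrite ge_min lexx orbT.
have gE0 e : (0 <= \int[quenched Q e]_o (Num.min (X 0%N o ^+ 2) 1)%:E)%E.
  by apply: integral_ge0 => o _; rewrite lee_fin.
have gfin e : (\int[quenched Q e]_o (Num.min (X 0%N o ^+ 2) 1)%:E)%E \is a fin_num.
  by rewrite ge0_fin_numE// (le_lt_trans (gE e))// ltry.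
have g01 e : 0 <= g e <= 1.
  by rewrite fine_ge0//= -lee_fin fineK.
have intm : (\int[mu]_e m e < +oo)%E.
  by rewrite ge0_integral_distribution.
have mpos_set : measurable [set o | 0 < X 0%N o].
  by rewrite -[X in measurable X]setTI; apply: measurable_fun_ltr.
(* The assumptions concern X_0 only; invariance under the shift transfers them to all shifted
   environments at once, hence to every X_k. *)
have F1 : {ae mu, forall e, forall k,
    ('E_(quenched Q (iter k (@Defs.shift R) e))[X 0%N] = 0)%E}.
  have mE : measurable_fun setT (fun e => 'E_(quenched Q e)[X 0%N])%E.
    have -> : (fun e => 'E_(quenched Q e)[X 0%N])%E =
        (fun e => \int[quenched Q e]_o (EFin \o X 0%N)^\+ o -
                  \int[quenched Q e]_o (EFin \o X 0%N)^\- o)%E.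
      by apply/funext => e; rewrite expectation.unlock integralE.
    by apply: emeasurable_funB; apply: measurable_quenched_integral => //;
      [apply: measurable_funepos|apply: measurable_funeneg]; exact/measurable_EFinP.
  have mA : measurable [set e | 'E_(quenched Q e)[X 0%N] = 0]%E.
    by rewrite -[X in measurable X]setTI; exact: (mE measurableT [set 0%E]).
  exact: (ae_preserving_iter mshift pres mA (env_law_ae mA centered)).
have F2 : {ae mu, forall e, forall k, (m (iter k (@Defs.shift R) e) < +oo)%E}.
  have mA : measurable [set e | (m e < +oo)%E].
    by rewrite -[X in measurable X]setTI; exact: emeasurable_fun_infty_o.
  apply: (ae_preserving_iter mshift pres mA).
  have im : mu.-integrable setT m.
    apply/integrableP; split => //.
    by under eq_integral do rewrite gee0_abs//.
  have := integrable_ae measurableT im; apply: filterS => e /(_ I).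
  by rewrite ge0_fin_numE.
have F3 := ae_blocks_finite mshift pres mm m0 intm b2.
have F4 : {ae mu, forall e, exists2 c : R, 0 < c &
    forall n, c * n%:R <= \sum_(k < n) g (iter k (@Defs.shift R) e)}.
  apply: ae_average_lower => //.
  have mA : measurable [set e | 0 < g e].
    by rewrite -[X in measurable X]setTI; apply: measurable_fun_ltr.
  apply: (env_law_ae mA); apply: filterS positive => w; set e := env_of xi w => pe.
  (* If g(e) = 0, then min(X_0^2, 1) vanishes almost surely, which contradicts the positive
     probability of X_0 > 0. *)
  have [/andP[+ _]] := (g01 e, tt); rewrite le_eqVlt => /predU1P[g0|//].
  have i0 : (\int[quenched Q e]_o (Num.min (X 0%N o ^+ 2) 1)%:E = 0)%E.
    by rewrite -(fineK (gfin e)) -/(g e) -g0.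
  have : ae_eq (quenched Q e) setT (fun o => (Num.min (X 0%N o ^+ 2) 1)%:E) (cst 0%E).
    apply/ae_eq_integral_abs => //.
    by under eq_integral do rewrite gee0_abs ?lee_fin//.
  move=> h; suff N0 : quenched Q e [set o | 0 < X 0%N o] = 0%E by rewrite N0 ltxx in pe.
  apply/negligibleP => //; apply: negligibleS h => o /= Xo /(_ I) -[].
  by apply/eqP; rewrite gt_eqF// lt_min exprn_gt0//= ltr01.
(* The conclusion is proved for almost every sequence under the law of the environment, then pulled
   back to P. For a sequence satisfying F1 to F4 the rest of the argument is deterministic. *)
have good : {ae mu, forall e, [/\ {ae quenched Q e, forall o, tau X y o != None},
    ((fine (\int[quenched Q e]_o (- S_tau X y o)%:E)%E)%:E =
      - 'E_(quenched Q e)[S_tau X y])%E &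
    Un Q X n e y @[n --> \oo] -->
      (fine (\int[quenched Q e]_o (- S_tau X y o)%:E)%E)%:E]}.
  apply: filterS2 (filterI F1 F2) (filterI F3 F4) => e [f1 f2] [f3 [c c0 f4]].
  have indep := (model e).1.
  have X0 k : centered_law (distribution (quenched Q e) (X k)).
    exact: (quenched_centered model eps0 (f2 k) (f1 k)).
  have vE k : (\int[quenched Q e]_o (Num.min (X k o ^+ 2) 1)%:E =
      (g (iter k (@Defs.shift R) e))%:E)%E.
    by rewrite (quenched_integral_iter model e k mmin)// fineK.
  have mE k : (\int[quenched Q e]_o (`|X k o| `^ (2 + eps))%:E =
      m (iter k (@Defs.shift R) e))%E.
    by rewrite (quenched_integral_iter model e k mp)// => x; exact: powR_ge0.
  have b0 : 0 < b by lra.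
  have mb k : (0 <= m (iter k (@Defs.shift R) e) < +oo)%E by rewrite m0 f2.
  have [D HD] := nneseries_block_bound b0 mb f3.
  have [|n|J|M [uM pM]] := @killed_bounded R d Om (quenched Q e) X y indep X0 y0
    eps r c D eps0 r02 c0.
  - by move=> n; rewrite mE f2.
  - by under eq_bigr do rewrite vE/=; exact: f4.
  - apply: le_trans (HD J); rewrite le_eqVlt; apply/orP; left; apply/eqP.
    by apply: eq_bigr => j _; congr (_ / _); apply: eq_bigr => k _; rewrite mE.
  have [l [lE ul]] := stopped_mean_cvg y0 indep X0 uM pM.
  split.
  - exact: ae_tau_finite pM.
  - rewrite lE/= -lE -[LHS]oppeK -integral_ge0N; last by move=> o _; exact: S0.
    rewrite expectation.unlock; congr (- _)%E; apply: eq_integral => o _.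
    by rewrite -EFinN opprK.
  - rewrite lE/=; apply: cvg_trans ul; apply: near_eq_cvg.
    by apply: nearW => n; rewrite UnE.
exact: (ae_env_law good).
Qed.
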